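(* Let $p\in[1,\infty]$, $K\in\mathbb{N}$, and let $v:\mathbb{Z}\to\mathbb{R}$ be $K$-periodic. Let $H$ be the $K$-periodic discrete Schrödinger operator on $\ell^p(\mathbb{Z})$ given by $(Hx)_k=x_{k-1}+x_{k+1}+v(k)x_k$, $k\in\mathbb{Z}$, and let $H_+$ be its restriction to $\ell^p(\mathbb{Z}_+)$ given by $(H_+x)_k=x_{k-1}+x_{k+1}+v(k)x_k$, $k\in\mathbb{Z}_+$, where $x_{-1}=0$. For $j\in\mathbb{Z}$ put $$M^{(j)}=\begin{pmatrix}-v(K-1+j)&-1\\1&0\end{pmatrix}\cdots\begin{pmatrix}-v(1+j)&-1\\1&0\end{pmatrix}\begin{pmatrix}-v(j)&-1\\1&0\end{pmatrix},$$ $$\widetilde M^{(j)}=\begin{pmatrix}-v(j)&-1\\1&0\end{pmatrix}\begin{pmatrix}-v(1+j)&-1\\1&0\end{pmatrix}\cdots\begin{pmatrix}-v(K-1+j)&-1\\1&0\end{pmatrix}.$$ Say that a real $2\times2$ matrix $M$ passes the test if $M_{2,1}\neq0$ or $|M_{1,1}|>1$. Then: (a) The FSM is applicable to $H$ if and only if $|\operatorname{tr}(M^{(0)})|>2$ and all of $M^{(0)},\dots,M^{(K-1)}$ and $\widetilde M^{(0)},\dots,\widetilde M^{(K-1)}$ pass the test. (b) The FSM is applicable to $H_+$ if and only if $|\operatorname{tr}(M^{(0)})|>2$ and all of $M^{(0)}$ and $\widetilde M^{(0)},\dots,\widetilde M^{(K-1)}$ pass the test. In particular, the FSM is applicable to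 $H_+$ if it is applicable to $H$. Moreover, $H_+$ is FSM-simple if $H$ is FSM-simple.
   Context: $\mathbb{Z}_+=\{0,1,2,\dots\}$; $\ell^p$ spaces consist of complex sequences. $v$ is $K$-periodic if $v(k+K)=v(k)$ for all $k\in\mathbb{Z}$. Operators are identified with their infinite matrices $(H_{ij})$ with respect to the canonical unit vectors. Finite section method (FSM): for $H$ on $\ell^p(\mathbb{Z})$ the $n$-th finite section is $H_n=(H_{ij})_{i,j=-n}^{n}$; for $H_+$ on $\ell^p(\mathbb{Z}_+)$ it is $H_n=(H_{ij})_{i,j=0}^{n}$. Each $H_n$ is regarded as an operator on the finite-dimensional space with the $\ell^p$-norm. The FSM is called applicable to $H$ (resp. $H_+$) if, for all sufficiently large $n$, the inverses $H_n^{-1}$ exist and (after embedding into an infinite matrix) approximate the inverse of the operator. This is used in the following equivalent form: the FSM is applicable if and only if (i) the operator is invertible on its $\ell^p$ space (as a bounded operator), (ii) all but finitely many $H_n$ are invertible, and (iii) their inverses are uniformly bounded, i.e. $\sup_{n\ge n_0}\|H_n^{-1}\|<\infty$ for some $n_0$. An operator is called FSM-simple if either the FSM is applicable to it or it is not invertible. *)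

(* Defs.v *)
From HB Require Import structures.
From mathcomp Require Import all_boot all_order all_algebra.
From mathcomp Require Import all_classical all_reals all_analysis.
From mathcomp Require Import complex.

Set Implicit Arguments.
Unset Strict Implicit.
Unset Printing Implicit Defensive.

Import Order.TTheory GRing.Theory Num.Theory.
Import ComplexField.

Local Open Scope classical_set_scope.
Local Open Scope complex_scope.
Local Open Scope ring_scope.

(* The discrete sigma-algebra on int and on 'I_n.+1, as the library has it on
   nat: every function on these index types is measurable, and the empty set is
   the only null set of the counting measure. A measurableType must be pointed,
   hence inhabited, which is why ordinals and sections have size n.+1. *)
HB.instance Definition _ := isPointed.Build int 0.
HB.instance Definition _ := @isMeasurable.Build default_measure_display
  int discrete_measurable discrete_measurable0
  discrete_measurableC discrete_measurableU.

HB.instance Definition _ (n : nat) := isPointed.Build 'I_n.+1 ord0.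
HB.instance Definition _ (n : nat) :=
  @isMeasurable.Build default_measure_display
  'I_n.+1 discrete_measurable discrete_measurable0
  discrete_measurableC discrete_measurableU.

Section Ellp.
Context {d : measure_display} {T : measurableType d} {R : realType}.
Local Notation C := R[i].
Implicit Types (p : \bar R) (x y : T -> C) (A : (T -> C) -> (T -> C)).

(* The l^p norm is the L^p norm for the counting measure; this is the usual one
   when T is discrete (nat, int, 'I_n.+1). It is +oo off l^p. *)
Definition ellp_norm p x : \bar R :=
  Lnorm counting p (fun k => (Normc.normc (x k))%:E).

Definition ellp p : set (T -> C) := [set x | (ellp_norm p x < +oo)%E].

(* An operator on l^p is represented by a map on all sequences, of which only
   the restriction to l^p matters. *)
Definition bounded_operator p A : Prop :=
  [/\ forall x, ellp p x -> ellp p (A x),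
      forall (a : C) x y, ellp p x -> ellp p y ->
        A (fun k => a * x k + y k) = (fun k => a * A x k + A y k)
    & exists c : R, forall x, ellp p x ->
        (ellp_norm p (A x) <= c%:E * ellp_norm p x)%E].

Definition invertible_operator p A : Prop :=
  bounded_operator p A /\
  exists B, bounded_operator p B /\
    forall x, ellp p x -> B (A x) = x /\ A (B x) = x.

Definition unit_vector (j : T) : T -> C := fun k => (k == j)%:R.

(* The submatrix of (A_{st})_{s,t}, where A_{st} = (A e_t)_s, whose rows and
   columns are listed by w. *)
Definition section_mx (m : nat) (w : 'I_m.+1 -> T) A : 'M[C]_m.+1 :=
  \matrix_(i, j) A (unit_vector (w j)) (w i).

End Ellp.

Definition ellp_opnorm {R : realType} {m : nat} (p : \bar R)
    (M : 'M[R[i]]_m.+1) : \bar R :=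
  ereal_sup [set ellp_norm p (fun i => (M *m u) i 0)
            | u in [set u : 'cV[R[i]]_m.+1 | (ellp_norm p (fun i => u i 0%R) <= 1)%E]].

Section FSM.
Context {d : measure_display} {T : measurableType d} {R : realType}.
(* The n-th section has size (N n).+1, and its index set is the range of w n. *)
Context {N : nat -> nat} (w : forall n, 'I_(N n).+1 -> T).
Implicit Types (p : \bar R) (A : (T -> R[i]) -> (T -> R[i])).

(* Invertibility together with stability, which characterizes convergence of the
   inverses of the sections to the inverse of A. *)
Definition fsm_applicable p A : Prop :=
  invertible_operator p A /\
  exists n0 : nat,
    (forall n, (n0 <= n)%N -> section_mx (@w n) A \in unitmx) /\
    (ereal_sup [set ellp_opnorm p (invmx (section_mx (@w n) A))
               | n in [set n | (n0 <= n)%N]] < +oo)%E.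

Definition fsm_simple p A : Prop :=
  fsm_applicable p A \/ ~ invertible_operator p A.

End FSM.

(* The windows {-n, ..., n} in Z and {0, ..., n} in Z_+. *)
Definition windowZ (n : nat) (i : 'I_(n.*2).+1) : int := i%:Z - n%:Z.
Definition windowN (n : nat) (i : 'I_n.+1) : nat := i.
Arguments windowZ : clear implicits.
Arguments windowN : clear implicits.

Section Schroedinger.
Context {R : realType}.
Context (v : int -> R).

Definition schroedinger (x : int -> R[i]) : int -> R[i] :=
  fun k => x (k - 1) + x (k + 1) + (v k)%:C * x k.

Definition schroedinger_half (x : nat -> R[i]) : nat -> R[i] :=
  fun k => (if k is l.+1 then x l else 0) + x k.+1 + (v k%:Z)%:C * x k.

Definition transfer (k : int) : 'M[R]_2 :=
  \matrix_(i < 2, j < 2)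
    if i == 0 then (if j == 0 then - v k else -1)
              else (if j == 0 then 1 else 0).

(* rev_ord i = K - 1 - i, so the leftmost factor is the one at K - 1 + j. *)
Definition monodromy (K : nat) (j : int) : 'M[R]_2 :=
  \prod_(i < K) transfer ((rev_ord i)%:Z + j).

Definition monodromy_rev (K : nat) (j : int) : 'M[R]_2 :=
  \prod_(i < K) transfer (i%:Z + j).

End Schroedinger.

Definition passes_test {R : realType} (M : 'M[R]_2) : bool :=
  (M 1 0 != 0) || (1 < `|M 0 0|).

(* Main.v *)
Require Import Defs.
From mathcomp Require Import all_boot all_order all_algebra.
From mathcomp Require Import all_classical all_reals all_analysis.
From mathcomp Require Import measurable_realfun ess_sup_inf complex.
From mathcomp Require Import zify ring lra.

Set Implicit Arguments.
Unset Strict Implicit.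
Unset Printing Implicit Defensive.

Import Order.TTheory GRing.Theory Num.Theory.
Import numFieldNormedType.Exports.

Local Open Scope classical_set_scope.
Local Open Scope ring_scope.

(** The solutions of u (k - 1) + u (k + 1) + v k u k = 0 form a plane on which
    translation by the period K acts as the monodromy matrix M, whose determinant
    is 1. Everything is decided by its trace.

    If |tr M| <= 2, every solution grows at most linearly
    (solution_linear_growth). Damped by q ^ |k| with q close to 1, a nonzero
    solution becomes a vector x of every l^p for which H x is small compared with
    x (schroedingerR_damped), so H has no bounded inverse. For H_+ the same
    argument is applied to the solution with u (-1) = 0.

    If |tr M| > 2, there are solutions up and um with real multipliers mu and
    1 / mu, |mu| < 1, which decay at +oo and at -oo (exists_floquet_pair). The test
    on the monodromy matrix at j fails exactly when up (j - 1) = 0, and the test on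
    the reversed product at j exactly when um j = 0 (passes_monodromy,
    passes_monodromy_rev): a decaying solution satisfies the Dirichlet condition at
    an end of a half-line.

    On an interval, finite or not, the inverse is given by Green's function
    u (min i j) w (max i j) / W, where u and w are um and up corrected so as to
    vanish at the left and at the right neighbour of the interval. As long as up
    and um are not too small at these neighbours, the corrections are under
    control and Green's function is at most C r ^ |i - j| with C independent of the
    interval (jacobi_uniform_bound). The Schur test (ellp_norm_schur) turns this
    into a bound in every l^p. It yields the inverses of H and H_+ as well as the
    uniform bounds for the inverses of the sections.

    Conversely, if up vanishes at a left neighbour, a section maps the restriction
    of up to a vector supported at the far right end, where up is exponentially
    smaller than near the left end. This happens for infinitely many sections of H,
    and the inverses of the sections have unbounded entries (stable_up_neq0).
    The right ends are treated in the same way (stable_um_neq0). For H_+, whose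
    left end is fixed, up (-1) = 0 makes up a null vector of H_+ itself.

    The last two claims follow from the characterizations. The conditions for H
    contain those for H_+, and H is invertible as soon as |tr M| > 2, which is
    necessary for the invertibility of H_+. *)

(** * Jensen's inequality and geometric sums *)

Section FiniteSums.
Context {R : realType}.

Lemma normc_ge0 (z : R[i]) : 0 <= Normc.normc z.
Proof. by case: z => a b; exact: sqrtr_ge0. Qed.

Lemma normc_real (a : R) : Normc.normc (real_complex R a) = `|a|.
Proof. by rewrite /= expr0n /= addr0 sqrtr_sqr. Qed.

Lemma normc_sum (I : Type) (s : seq I) (F : I -> R[i]) :
  Normc.normc (\sum_(i <- s) F i) <= \sum_(i <- s) Normc.normc (F i).
Proof.
elim/big_ind2 : _ => //; first by rewrite Normc.normc0.
by move=> a b c e ab ce; apply: le_trans (lerD ab ce); exact: le_normcD.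
Qed.

Lemma ler_sum_uniq (I : eqType) (s1 s2 : seq I) (F : I -> R) :
  uniq s1 -> uniq s2 -> {subset s1 <= s2} -> (forall i, 0 <= F i) ->
  \sum_(i <- s1) F i <= \sum_(i <- s2) F i.
Proof.
move=> u1 u2 s12 F0; rewrite [leRHS](bigID (mem s1))/= -[leLHS]addr0.
apply: lerD; last exact: sumr_ge0.
rewrite -[leRHS]big_filter le_eqVlt; apply/orP; left; apply/eqP.
apply: perm_big; apply: uniq_perm; rewrite ?filter_uniq// => t.
by rewrite mem_filter andb_idr//; exact: s12.
Qed.

(** The graph of the q-th power lies above its tangent at t: this is Young's
    inequality for a and t ^ (q - 1), whose conjugate exponent is q / (q - 1). *)
Lemma powR_tangent (q a t : R) : 1 <= q -> 0 <= a -> 0 <= t ->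
  q * t `^ (q - 1) * a <= a `^ q + (q - 1) * t `^ q.
Proof.
move=> q1 a0 t0; have [->|q1'] := eqVneq q 1.
  by rewrite subrr powRr0 !mul1r mul0r addr0 powRr1.
have {q1'}q1 : 1 < q by rewrite lt_neqAle eq_sym q1'.
have q0 : 0 < q by lra.
have qq0 : 0 < q / (q - 1) by apply: divr_gt0; lra.
have qn0 : q != 0 by rewrite gt_eqF.
have qn1 : q - 1 != 0 by rewrite gt_eqF// subr_gt0.
have := conjugate_powR a0 (powR_ge0 t (q - 1)) q0 qq0.
rewrite -powRrM (_ : (q - 1) * (q / (q - 1)) = q); last by field.
move=> /(_ ltac:(by field; rewrite qn0 qn1)) H.
rewrite -mulrA (mulrC (t `^ _)) -ler_pdivlMl//; apply: le_trans H _.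
rewrite le_eqVlt; apply/orP; left; apply/eqP; field.
by rewrite qn0 qn1.
Qed.

(** Jensen's inequality for weights of total mass at most 1, obtained by summing
    the tangent inequality at the mean t. The missing mass only helps, since the
    power vanishes at 0. *)
Lemma powR_jensen (I : Type) (s : seq I) (w a : I -> R) (q : R) : 1 <= q ->
  (forall i, 0 <= w i) -> (forall i, 0 <= a i) -> \sum_(i <- s) w i <= 1 ->
  (\sum_(i <- s) w i * a i) `^ q <= \sum_(i <- s) w i * a i `^ q.
Proof.
move=> q1 w0 a0 w1; set t := \sum_(i <- s) w i * a i.
have t0 : 0 <= t by apply: sumr_ge0 => i _; rewrite mulr_ge0.
have H : \sum_(i <- s) w i * (q * t `^ (q - 1) * a i - (q - 1) * t `^ q)
    <= \sum_(i <- s) w i * a i `^ q.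
  apply: ler_sum => i _; apply: ler_wpM2l => //.
  by rewrite lerBlDr; exact: powR_tangent.
apply: le_trans H; under eq_bigr do rewrite mulrBr mulrCA.
rewrite sumrB -mulr_sumr -mulr_suml -/t -mulrA (mulrC _ t) mulr_powRB1//; last lra.
have := powR_ge0 t q; set tq := t `^ q; set W := \sum_(i <- s) w i in w1 *.
move=> tq0; have : 0 <= (1 - W) * (q - 1) * tq.
  by rewrite !mulr_ge0// subr_ge0.
lra.
Qed.

Lemma sum_geometric_nat (r : R) (s : seq nat) : 0 < r < 1 -> uniq s ->
  \sum_(n <- s) r ^+ n <= (1 - r)^-1.
Proof.
move=> /andP[r0 r1] us; pose N := \max_(n <- s) n.
have sN n : n \in s -> (n <= N)%N by move=> ns; exact: leq_bigmax_seq.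
have -> : \sum_(n <- s) r ^+ n =
    \sum_(i <- [seq inord n | n <- s] : seq 'I_N.+1) r ^+ i.
  rewrite big_map; apply: eq_big_seq => n ns.
  by rewrite inordK// ltnS sN.
rewrite big_uniq; last first.
  rewrite map_inj_in_uniq// => m n ms ns /(congr1 val).
  by rewrite /= !inordK ?ltnS ?sN.
apply: (@le_trans _ _ (\sum_(i < N.+1) r ^+ i)).
  rewrite big_mkcond; apply: ler_sum => i _; case: ifP => // _.
  by rewrite exprn_ge0// ltW.
have r1' : 0 < 1 - r by rewrite subr_gt0.
rewrite -(ler_pM2l r1') mulfV ?gt_eqF//.
have -> : (1 - r) * \sum_(i < N.+1) r ^+ i = 1 - r ^+ N.+1.
  by rewrite -[RHS]opprB subrX1 -mulNr opprB.
by rewrite gerBl exprn_ge0// ltW.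
Qed.

Lemma sum_geometric_int (r : R) (s : seq int) : 0 < r < 1 -> uniq s ->
  \sum_(z <- s) r ^+ `|z|%N <= 2 / (1 - r).
Proof.
move=> r01 us; rewrite (bigID (fun z : int => 0 <= z))/=.
rewrite mulr_natl mulr2n; apply: lerD; rewrite -big_filter -(big_map absz xpredT (fun n => r ^+ n)).
- apply: sum_geometric_nat => //; rewrite map_inj_in_uniq ?filter_uniq//.
  by move=> x y; rewrite !mem_filter => /andP[x0 _] /andP[y0 _]; lia.
- apply: sum_geometric_nat => //; rewrite map_inj_in_uniq ?filter_uniq//.
  by move=> x y; rewrite !mem_filter => /andP[x0 _] /andP[y0 _]; lia.
Qed.
End FiniteSums.

(** * The norm of l^p over a discrete index set *)

Section Norm.
Context {d : measure_display} {T : measurableType d} {R : realType}.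
Context (iota : T -> int) (iota_inj : injective iota).
Context (measurable_all : forall A : set T, measurable A).
Implicit Types (p : \bar R) (x y : T -> R[i]).

Local Notation mu := (@counting T R : {measure set T -> \bar R}).

(** The counting measure has no nonempty null set. *)
Lemma ae_counting (P : T -> Prop) : {ae mu, forall t, P t} -> forall t, P t.
Proof.
move=> [N [_ + NP]] t; rewrite /= /counting; case: ifPn => // /asboolP finN.
move=> /eqP; rewrite eqe pnatr_eq0 finmap.cardfs_eq0 => /eqP N0.
have {}N0 : N = set0 by rewrite -(fset_setK finN) N0 set_fset0.
by apply: contrapT => nPt; have : N t; [exact: NP | rewrite N0].
Qed.

Lemma measurable_fun_counting (D : set T) (f : T -> \bar R) :
  measurable_fun D f.
Proof. by move=> _ Y _; exact: measurable_all. Qed.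

Lemma integral_counting_seq (f : T -> \bar R) (s : seq T) : uniq s ->
  (forall t, 0 <= f t)%E ->
  (\int[mu]_(t in [set` s]) f t = \sum_(t <- s) f t)%E.
Proof.
move=> us f0; have -> : [set` s] = \big[setU/set0]_(t <- s) [set t].
  rewrite -bigcup_seq; apply/seteqP; split => [t ts|t [u /= us' ->]//].
  by exists t.
rewrite ge0_integral_bigsetU//.
- apply: eq_bigr => t _.
  rewrite (eq_integral (cst (f t))) => [|u]; last by rewrite inE => ->.
  rewrite integral_cst// [X in (_ * X)%E](_ : _ = 1%E) ?mule1//.
  rewrite /= /counting asboolT; last exact: finite_set1.
  by rewrite fset_set1 finmap.cardfs1.
- by move=> i j _ _ [t [/= <- <-]].
Qed.

Lemma le_integral_counting_seq (f : T -> \bar R) (s : seq T) : uniq s ->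
  (forall t, 0 <= f t)%E ->
  (\sum_(t <- s) f t <= \int[mu]_t f t)%E.
Proof.
move=> us f0; rewrite -integral_counting_seq//.
exact: ge0_subset_integral.
Qed.

(** The integral is the supremum of the finite sums: the injection of T into the
    integers exhausts T by finite sets, and monotone convergence applies. *)
Lemma integral_counting_le (f : T -> \bar R) (M : \bar R) :
  (forall t, 0 <= f t)%E ->
  (forall s, uniq s -> \sum_(t <- s) f t <= M)%E ->
  (\int[mu]_t f t <= M)%E.
Proof.
move=> f0 fM; pose F n := (pickle \o iota) @^-1` `I_n.
have FT : \bigcup_n F n = setT.
  by apply/seteqP; split => // t _; exists (pickle (iota t)).+1; rewrite /F //=.
have cvF := @ge0_nondecreasing_set_cvg_integral _ _ _ F f mu.
rewrite -FT -(cvg_lim _ (cvF _ _ _ _))//.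
- apply: lime_le.
    apply/cvg_ex; eexists; apply: cvF => //.
    by move=> m n mn; apply/subsetPset => t /= /leq_trans; exact.
    by move=> i; exact: measurable_fun_counting.
  apply: nearW => n.
  have /finite_seqP[s Fs] : finite_set (F n).
    apply: finite_preimage; last exact: finite_II.
    by apply: in2W; exact: inj_comp (pcan_inj pickleK) iota_inj.
  have -> : F n = [set` undup s] by rewrite Fs; apply/seteqP; split => t /=; rewrite mem_undup.
  by rewrite integral_counting_seq ?undup_uniq//; apply: fM; exact: undup_uniq.
- by move=> m n mn; apply/subsetPset => t /= /leq_trans; exact.
- by move=> i; exact: measurable_fun_counting.
Qed.

Lemma ellp_normE (q : R) x : ellp_norm q%:E x =
  ((\int[mu]_t ((Normc.normc (x t)) `^ q)%:E) `^ q^-1)%E.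
Proof.
rewrite /ellp_norm unlock; congr (_ `^ _)%E; apply: eq_integral => t _.
by rewrite abse_EFin poweR_EFin ger0_norm ?normc_ge0.
Qed.

Lemma ellp_norm_infE x : ellp_norm +oo%E x =
  ess_sup mu (fun t => (Normc.normc (x t))%:E).
Proof.
rewrite /ellp_norm unlock; case: ifPn => [_|]; last first.
  rewrite -leNgt => mu0; exfalso.
  have [t] : inhabited T by constructor; exact: point.
  apply: (ae_counting (P := fun=> False)) => //; exists setT; split => //.
  by apply/eqP; rewrite eq_le mu0 measure_ge0.
by congr ess_sup; apply/funext => t /=; rewrite ger0_norm// normc_ge0.
Qed.

Lemma normc_le_ellp_norm p x t : (1 <= p)%E ->
  ((Normc.normc (x t))%:E <= ellp_norm p x)%E.
Proof.
case: p => [q|_|//]; last first.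
  rewrite ellp_norm_infE.
  exact: (ae_counting (P := fun t => (_ t <= _)%E) (@ess_sup_ge _ _ _ mu _)).
rewrite lee_fin => q1; have q0 : 0 < q by lra.
rewrite ellp_normE.
have -> : (Normc.normc (x t))%:E = (((Normc.normc (x t)) `^ q)%:E `^ q^-1)%E.
  by rewrite poweR_EFin -powRrM mulfV ?gt_eqF// powRr1// normc_ge0.
apply: gt0_ler_poweR; rewrite ?invr_ge0 ?(ltW q0)//.
- by rewrite in_itv/= leey lee_fin powR_ge0.
- by rewrite in_itv/= leey integral_ge0// => u _; rewrite lee_fin powR_ge0.
have := @le_integral_counting_seq (fun t => ((Normc.normc (x t)) `^ q)%:E) [:: t].
by rewrite big_seq1; apply => // u; rewrite lee_fin powR_ge0.
Qed.

Lemma ellp_norm_unit p t : (1 <= p)%E -> (ellp_norm p (unit_vector t : T -> R[i]) <= 1)%E.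
Proof.
have ut u : Normc.normc ((unit_vector t : T -> R[i]) u) = (u == t)%:R.
  by rewrite /unit_vector; case: (u == t); rewrite ?Normc.normc1 ?Normc.normc0.
case: p => [q|_|//]; last first.
  rewrite ellp_norm_infE; apply/ess_supP; apply: nearW => u.
  by rewrite ut; case: (u == t).
rewrite lee_fin => q1; have q0 : 0 < q by lra.
rewrite ellp_normE.
have -> : 1%E = (1%E `^ q^-1)%E :> \bar R by rewrite poweR1r.
apply: gt0_ler_poweR; rewrite ?invr_ge0 ?(ltW q0)//.
- by rewrite in_itv/= leey integral_ge0// => u _; rewrite lee_fin powR_ge0.
- by rewrite in_itv/= leey lee01.
apply: integral_counting_le => [u|s us]; first by rewrite lee_fin powR_ge0.
rewrite sumEFin lee_fin; have [ts|ts] := boolP (t \in s).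
  rewrite (bigD1_seq t)//= ut eqxx powR1 big1 ?addr0// => u ut'.
  by rewrite ut (negbTE ut') powR0// gt_eqF.
rewrite big1_seq// => u /andP[_ us']; rewrite ut.
by rewrite (_ : u == t = false) ?powR0 ?gt_eqF//; apply: contraNF ts => /eqP <-.
Qed.

(** Rows and columns of the kernel r ^ |i - j| have the same bound, whatever the
    set T of integers that indexes them. *)
Lemma sum_kernel_le (r : R) (s : seq T) (k : int) : 0 < r < 1 -> uniq s ->
  \sum_(t <- s) r ^+ `|iota t - k|%N <= 2 / (1 - r).
Proof.
move=> r01 us; rewrite -(big_map (fun t => iota t - k) xpredT (fun z : int => r ^+ `|z|%N)).
apply: sum_geometric_int => //; rewrite map_inj_uniq// => t u.
by move=> /(congr1 (fun z => z + k)); rewrite !subrK => /iota_inj.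
Qed.

(** The Schur test for a kernel with geometric decay off the diagonal. It is
    uniform in p and in T, hence in the size of a section. Each y k is dominated by
    a finite sum, which suffices for infinite kernels as well: a convergent series
    with nonzero sum is at most twice one of its partial sums. The factor
    2 / (1 - r) bounds all row and column sums of r ^ |i - j|. *)
Lemma ellp_norm_schur p (C r : R) x y : (1 <= p)%E -> 0 < C -> 0 < r < 1 ->
  (forall k, exists2 s, uniq s & Normc.normc (y k) <=
     \sum_(j <- s) C * r ^+ `|iota k - iota j|%N * Normc.normc (x j)) ->
  (ellp_norm p y <= (C * (2 / (1 - r)))%:E * ellp_norm p x)%E.
Proof.
move=> p1 C0 r01 yx; have [r0 r1] := andP r01.
set G := 2 / (1 - r); have G0 : 0 < G by rewrite divr_gt0// subr_gt0.
have rk k j : 0 <= r ^+ `|iota k - iota j|%N by rewrite exprn_ge0// ltW.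
case: p p1 => [q|p1|//]; last first.
  rewrite !ellp_norm_infE; apply/ess_supP; apply: nearW => k.
  have [X Xe] : exists X : R, ess_sup mu (fun t => (Normc.normc (x t))%:E) = X%:E \/
    ess_sup mu (fun t => (Normc.normc (x t))%:E) = +oo%E.
    have : (0 <= ess_sup mu (fun t => (Normc.normc (x t))%:E))%E.
      rewrite -ellp_norm_infE; apply: le_trans (normc_le_ellp_norm x k _) => //.
      by rewrite lee_fin normc_ge0.
    by case: (ess_sup mu _) => [z _|_|//]; [exists z; left|exists 0; right].
  case: Xe => Xe; rewrite Xe; last first.
    by rewrite gt0_muley ?leey// lte_fin mulr_gt0.
  have [s us ys] := yx k.
  rewrite -EFinM lee_fin; apply: le_trans ys _.
  apply: (@le_trans _ _ (\sum_(j <- s) C * r ^+ `|iota j - iota k|%N * X)).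
    apply: ler_sum => j _; rewrite distnC; apply: ler_wpM2l.
      by rewrite mulr_ge0 ?(ltW C0)// rk.
    by rewrite -lee_fin -Xe -ellp_norm_infE normc_le_ellp_norm.
  have X0 : 0 <= X.
    rewrite -lee_fin -Xe -ellp_norm_infE.
    by apply: le_trans (normc_le_ellp_norm x k _); rewrite ?lee_fin ?normc_ge0.
  rewrite -mulr_suml; apply: ler_wpM2r => //.
  by rewrite -mulr_sumr ler_pM2l//; exact: sum_kernel_le.
rewrite lee_fin => q1; have q0 : 0 < q by lra.
have nx k : 0 <= Normc.normc (x k) `^ q by exact: powR_ge0.
rewrite !ellp_normE; set CG := C * G; have CG0 : 0 < CG by exact: mulr_gt0.
have qi0 : 0 <= q^-1 by rewrite invr_ge0 ltW.
have int0 z : (0 <= \int[mu]_t ((Normc.normc (z t)) `^ q)%:E)%E.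
  by apply: integral_ge0 => u _; rewrite lee_fin powR_ge0.
have -> : CG%:E = ((CG `^ q)%:E `^ q^-1)%E.
  by rewrite poweR_EFin -powRrM mulfV ?gt_eqF// powRr1// ltW.
rewrite -poweRM// ?lee_fin ?powR_ge0//.
apply: gt0_ler_poweR => //; rewrite ?in_itv/= ?leey ?int0 ?andbT//.
  by rewrite mule_ge0// lee_fin powR_ge0.
apply: integral_counting_le => [t|s0 us0]; first by rewrite lee_fin powR_ge0.
(* One finite index set serves all k in s0, since enlarging it only increases
   the dominating sums. *)
have {yx} [s us ys] : exists2 s, uniq s & {in s0, forall k, Normc.normc (y k) <=
     \sum_(j <- s) C * r ^+ `|iota k - iota j|%N * Normc.normc (x j)}.
  elim: s0 {us0} => [|k s0 [s us IH]]; first by exists [::].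
  have [s' us' ks'] := yx k; exists (undup (s ++ s')); first exact: undup_uniq.
  move=> j; rewrite inE => /predU1P[->|js0].
    apply: le_trans ks' _; apply: ler_sum_uniq => //; rewrite ?undup_uniq//.
      by move=> t ts; rewrite mem_undup mem_cat ts orbT.
    by move=> t; rewrite !mulr_ge0 ?normc_ge0// ltW.
  apply: le_trans (IH _ js0) _; apply: ler_sum_uniq => //; rewrite ?undup_uniq//.
    by move=> t ts; rewrite mem_undup mem_cat ts.
  by move=> t; rewrite !mulr_ge0 ?normc_ge0// ltW.
(* Normalized weights: all row and column sums are at most 1. *)
pose th k j := r ^+ `|iota k - iota j|%N / G.
have th0 k j : 0 <= th k j by rewrite divr_ge0// ltW.
apply: (@le_trans _ _ ((CG `^ q)%:E * \sum_(j <- s) ((Normc.normc (x j)) `^ q)%:E))%E; last first.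
  rewrite lee_pmul2l// ?lte_fin ?powR_gt0//.
  apply: le_integral_counting_seq => // t; rewrite lee_fin powR_ge0//.
rewrite !sumEFin -EFinM lee_fin.
have H k : k \in s0 -> Normc.normc (y k) `^ q <=
    CG `^ q * \sum_(j <- s) th k j * Normc.normc (x j) `^ q.
  move=> ks0; apply: (@le_trans _ _ ((CG * \sum_(j <- s) th k j * Normc.normc (x j)) `^ q)).
    apply: ge0_ler_powR; rewrite ?(ltW q0) ?nnegrE ?normc_ge0//.
      rewrite mulr_ge0 ?(ltW CG0)// sumr_ge0// => j _.
      by rewrite mulr_ge0 ?normc_ge0.
    apply: le_trans (ys _ ks0) _; rewrite mulr_sumr le_eqVlt; apply/orP; left.
    apply/eqP/eq_bigr => j _; rewrite /th /CG; field; by rewrite gt_eqF.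
  rewrite powRM ?(ltW CG0)//; last by apply: sumr_ge0 => j _; rewrite mulr_ge0 ?normc_ge0.
  rewrite ler_pM2l ?powR_gt0//; apply: powR_jensen => //; first by move=> j; exact: normc_ge0.
  rewrite -mulr_suml ler_pdivrMr// mul1r.
  under eq_bigr do rewrite distnC; exact: sum_kernel_le.
rewrite big_seq; apply: le_trans (ler_sum _ H) _.
rewrite -mulr_sumr ler_pM2l ?powR_gt0// -big_seq exchange_big/=.
apply: ler_sum => j _; rewrite -mulr_suml ler_piMl//.
by rewrite -mulr_suml ler_pdivrMr// mul1r; exact: sum_kernel_le.
Qed.

End Norm.

(** * Sums over the integers *)

Section Isum.
Context {R : realType} (r : R) (r01 : 0 < r < 1).
Implicit Types (f g : int -> R).

Definition exp_decay f := exists D : R, forall j, `|f j| <= D * r ^+ `|j|%N.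

Definition partial_isum f (n : nat) : R :=
  \sum_(0 <= i < n) (f i%:Z + f (Negz i)).

(** The limit of the sums over -n <= j < n; meaningful for the exponentially
    decaying summands below, for which the series converges absolutely. *)
Definition isum f : R := limn (partial_isum f).

Definition window (n : nat) : seq int :=
  [seq i%:Z | i <- index_iota 0 n] ++ [seq Negz i | i <- index_iota 0 n].

Lemma window_uniq n : uniq (window n).
Proof.
rewrite cat_uniq !map_inj_uniq ?iota_uniq ?andbT/=; try by move=> ? ? [].
by apply/hasPn => z /mapP[i _ ->]; apply/mapP => -[].
Qed.

Lemma partial_isumE f n : partial_isum f n = \sum_(j <- window n) f j.
Proof. by rewrite /partial_isum big_split big_cat !big_map. Qed.

Lemma exp_decayD (a : R) f g : exp_decay f -> exp_decay g ->
  exp_decay (fun j => a * f j + g j).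
Proof.
move=> [D fD] [E gE]; exists (`|a| * D + E) => j.
apply: le_trans (ler_normD _ _) _; rewrite normrM mulrDl -mulrA.
by apply: lerD => //; exact: ler_wpM2l.
Qed.

Lemma isum_cvg f : exp_decay f -> partial_isum f @ \oo --> isum f.
Proof.
move=> [D fD]; have [r0 r1] := andP r01.
have D0 : 0 <= D by have := fD 0; rewrite expr0 mulr1; exact: le_trans.
rewrite /isum; apply: (@normed_cvg _ R^o (fun i => f i%:Z + f (Negz i))).
apply: (@series_le_cvg _ _ (geometric (D + D) r)) => [n|n|n|].
- exact: normr_ge0.
- by rewrite /geometric /= mulr_ge0 ?addr_ge0 ?exprn_ge0// ltW.
- rewrite /geometric/= mulrDl; apply: le_trans (ler_normD _ _) _; apply: lerD.
    exact: fD.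
  apply: le_trans (fD _) _; apply: ler_wpM2l => //=.
  by rewrite exprS ler_piMl ?exprn_ge0 ?ltW.
- by apply: is_cvg_geometric_series; rewrite ger0_norm ?ltW.
Qed.

Lemma isumD (a : R) f g : exp_decay f -> exp_decay g ->
  isum (fun j => a * f j + g j) = a * isum f + isum g.
Proof.
move=> fd gd; apply/cvg_lim => //.
rewrite (_ : partial_isum _ = (fun n => a * partial_isum f n + partial_isum g n)).
  by apply: cvgD; [apply: cvgM; [exact: cvg_cst|exact: isum_cvg]|exact: isum_cvg].
apply/funext => n; rewrite !partial_isumE mulr_sumr -big_split.
by apply: eq_bigr.
Qed.

Lemma mem_window k n : (`|k| < n)%N -> k \in window n.
Proof.
move=> kn; rewrite mem_cat; case: k kn => i /= kn; apply/orP; [left|right].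
  by apply: map_f; rewrite mem_index_iota.
by apply: map_f; rewrite mem_index_iota; apply: ltn_trans kn; exact: ltnSn.
Qed.

Lemma isum_delta f (k : int) : (forall j, j != k -> f j = 0) -> isum f = f k.
Proof.
move=> fk; apply/cvg_lim => //; apply: cvg_near_cst.
near=> n; rewrite partial_isumE (bigD1_seq k)/= ?window_uniq//; last first.
  by apply: mem_window; near: n; exact: nbhs_infty_gt.
by rewrite big1 ?addr0// => j /fk.
Unshelve. all: by end_near. Qed.

(** Summation by parts: only the boundary terms at n - 1 and - n - 1 survive in
    the partial sums, and they tend to 0. *)
Lemma isum_telescope f : exp_decay f -> isum (fun j => f j - f (j - 1)) = 0.
Proof.
move=> [D fD]; have [r0 r1] := andP r01; apply/cvg_lim => //.
rewrite (_ : partial_isum _ = fun n => f (n%:Z - 1) - f (- n%:Z - 1)); last first.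
  apply/funext; elim => [|n IH]; first by rewrite /partial_isum big_geq// oppr0 subrr.
  rewrite /partial_isum big_nat_recr//=.
  rewrite /partial_isum in IH; rewrite IH.
  have -> : n.+1%:Z - 1 = n by lia.
  have -> : Negz n - 1 = - n.+1%:Z - 1 by lia.
  have -> : Negz n = - n%:Z - 1 by lia.
  ring.
have f0 (u : nat -> int) : (forall n, (n <= `|u n|.+1)%N) -> f (u n) @[n --> \oo] --> 0.
  move=> un; apply: norm_cvg0; apply: (@squeeze_cvgr _ _ _ _ (fun=> 0) (geometric (D / r) r)).
  - near=> n; rewrite normr_ge0 /geometric/=; apply: le_trans (fD _) _.
    have D0 : 0 <= D by have := fD 0; rewrite expr0 mulr1; exact: le_trans.
    rewrite -mulrA; apply: ler_wpM2l => //.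
    rewrite ler_pdivlMl// -exprS; apply: ler_wiXn2l; rewrite ?(ltW r0) ?(ltW r1)//.
  - exact: cvg_cst.
  - by apply: cvg_geometric; rewrite ger0_norm ?ltW.
rewrite -[X in _ --> X](subrr 0); apply: cvgB; apply: f0 => n; lia.
Unshelve. all: by end_near. Qed.
End Isum.

(** * The difference equation *)

Section Solutions.
Context {R : realType}.
Implicit Types (v u w : int -> R).

(** The action of the operator on real sequences. The potential, the solutions
    and Green's function are real, so that complex sequences are needed only in the
    statements about l^p. *)
Definition schroedingerR v u (k : int) : R := u (k - 1) + u (k + 1) + v k * u k.

Definition solution v u := forall k, schroedingerR v u k = 0.

Lemma int_shift_ind (P : int -> Prop) (j : int) : P j ->
  (forall k, P k -> P (k + 1)) -> (forall k, P k -> P (k - 1)) -> forall k, P k.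
Proof.
move=> Pj PS PN k; have Pn n : P (j + n%:Z) /\ P (j - n%:Z).
  elim: n => [|n [IH1 IH2]]; first by have : P (j + 0) /\ P (j - 0) by rewrite addr0 ?subr0.
  split; first by rewrite (_ : _ + _ = j + n%:Z + 1); [exact: PS|lia].
  by rewrite (_ : j - _ = j - n%:Z - 1); [exact: PN|lia].
have [jk|kj] := leP j k.
  by rewrite (_ : k = j + `|k - j|%N%:Z); [case: (Pn `|k - j|%N)|lia].
by rewrite (_ : k = j - `|k - j|%N%:Z); [case: (Pn `|k - j|%N)|lia].
Qed.

Section Existence.
Context (v : int -> R) (a b : R).

(** The recurrence run to the right from (u 0, u (-1)): the pair (u n, u (n - 1)). *)
Fixpoint forward_pair (n : nat) : R * R :=
  if n is m.+1 then
    let: (x, y) := forward_pair m in (- (v m%:Z * x) - y, x)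
  else (a, b).

(** The recurrence run to the left from the same data: the pair
    (u (- n), u (- n - 1)). *)
Fixpoint backward_pair (n : nat) : R * R :=
  if n is m.+1 then
    let: (x, y) := backward_pair m in (y, - (v (Negz m) * y) - x)
  else (a, b).

Lemma solution_exists : exists u, [/\ solution v u, u 0 = a & u (-1) = b].
Proof.
pose u (k : int) := match k with
  | Posz n => (forward_pair n).1 | Negz n => (backward_pair n).2 end.
exists u; split=> // -[n|n]; rewrite /schroedingerR.
- have -> : u (n%:Z - 1) = (forward_pair n).2.
    case: n => [//|n]; rewrite (_ : n.+1%:Z - 1 = n%:Z); last lia.
    by rewrite /u /=; case: (forward_pair n).
  rewrite (_ : n%:Z + 1 = n.+1%:Z); last lia.
  by rewrite /u /=; case: (forward_pair n) => x y /=; ring.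
- have -> : u (Negz n + 1) = (backward_pair n).1.
    case: n => [//|n]; rewrite (_ : Negz n.+1 + 1 = Negz n); last lia.
    by rewrite /u /=; case: (backward_pair n).
  rewrite (_ : Negz n - 1 = Negz n.+1); last lia.
  by rewrite /u /=; case: (backward_pair n) => x y /=; ring.
Qed.
End Existence.

Lemma solution_eq0 v u (j : int) : solution v u -> u j = 0 -> u (j - 1) = 0 ->
  forall k, u k = 0.
Proof.
move=> us uj uj1 k; suff : u k = 0 /\ u (k - 1) = 0 by case.
move: k; apply: (int_shift_ind (j := j)) => // k [uk uk1]; have := us k;
  rewrite /schroedingerR uk uk1.
- by rewrite mulr0 add0r addr0 => ->; rewrite addrK.
- have := us (k - 1); rewrite /schroedingerR subrK uk uk1 mulr0 !addr0 => -> _.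
  by split.
Qed.

Lemma solution_lin v u w a b : solution v u -> solution v w ->
  solution v (fun k => a * u k + b * w k).
Proof.
move=> us ws k; rewrite /schroedingerR.
transitivity (a * schroedingerR v u k + b * schroedingerR v w k); first by rewrite /schroedingerR; ring.
by rewrite us ws !mulr0 addr0.
Qed.

Definition wronskian u w (k : int) : R := u k * w (k + 1) - u (k + 1) * w k.

(** The two recurrences have the same potential, and their off-diagonal
    coefficients are 1, so the potential cancels. *)
Lemma wronskian_cst v u w k j : solution v u -> solution v w ->
  wronskian u w k = wronskian u w j.
Proof.
move=> us ws; suff {k} W1 k : wronskian u w (k - 1) = wronskian u w k.
  move: k; apply: (int_shift_ind (j := j)) => // k <-; last exact: W1.
  by rewrite -(W1 (k + 1)) addrK.
have := us k; have := ws k; rewrite /wronskian /schroedingerR subrK.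
move=> /eqP; rewrite addrAC addrC addr_eq0 => /eqP ->.
move=> /eqP; rewrite addrAC addrC addr_eq0 => /eqP ->.
ring.
Qed.
End Solutions.

(** * Monodromy matrices *)

Section Monodromy.
Context {R : realType} (v : int -> R).
Implicit Types (u w : int -> R).

Lemma monodromyS K j :
  monodromy v K.+1 j = transfer v (K%:Z + j) *m monodromy v K j.
Proof.
by rewrite /monodromy big_ord_recl /= subn1.
Qed.

Lemma det_mx2 (M : 'M[R]_2) : \det M = M 0 0 * M 1 1 - M 0 1 * M 1 0.
Proof.
rewrite (expand_det_row _ ord0) !big_ord_recl big_ord0 addr0 /cofactor !det_mx11 !mxE /=.
have -> : lift ord0 ord0 = 1 :> 'I_2 by apply: val_inj.
have -> : lift 1 ord0 = 0 :> 'I_2 by apply: val_inj.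
by rewrite !expr0 expr1 mul1r mulN1r mulrN.
Qed.

Lemma det_transfer k : \det (transfer v k) = 1.
Proof. by rewrite det_mx2 !mxE /=; ring. Qed.

Lemma det_monodromy K j : \det (monodromy v K j) = 1.
Proof.
elim: K => [|K IH]; first by rewrite /monodromy big_ord0 det1.
by rewrite monodromyS det_mulmx det_transfer IH mulr1.
Qed.

(** The transfer matrix at k maps (u k, u (k - 1)) to (u (k + 1), u k), so the
    monodromy matrix at j moves the state at j to the state at j + K. *)
Lemma monodromyE K j u : solution v u ->
  let M := monodromy v K j in
  u (K%:Z + j) = M 0 0 * u j + M 0 1 * u (j - 1) /\
  u (K%:Z + j - 1) = M 1 0 * u j + M 1 1 * u (j - 1).
Proof.
move=> us; elim: K => [|K [IH1 IH2]] /=.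
  by rewrite /monodromy big_ord0 !mxE /= add0r; split; ring.
rewrite monodromyS !mxE !big_ord_recl !big_ord0 !mxE /=.
have -> : K.+1%:Z + j = K%:Z + j + 1 by lia.
have := us (K%:Z + j); rewrite /schroedingerR addrK => /eqP.
rewrite addrAC addrC addr_eq0 => /eqP ->; rewrite IH1 IH2.
have -> : lift ord0 ord0 = 1 :> 'I_2 by apply: val_inj.
by split; ring.
Qed.

(** Read from right to left, the same transfer matrices propagate the reflected
    state (u k, u (k + 1)) to the left; the reversed product therefore moves the
    reflected state at j + K - 1 to the one at j - 1. *)
Lemma monodromy_revE K j u : solution v u ->
  let M := monodromy_rev v K j in
  u (j - 1) = M 0 0 * u (K%:Z + j - 1) + M 0 1 * u (K%:Z + j) /\
  u j = M 1 0 * u (K%:Z + j - 1) + M 1 1 * u (K%:Z + j).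
Proof.
move=> us; elim: K => [|K [IH1 IH2]] /=.
  by rewrite /monodromy_rev big_ord0 !mxE /= add0r; split; ring.
have -> : monodromy_rev v K.+1 j = monodromy_rev v K j *m transfer v (K%:Z + j).
  by rewrite /monodromy_rev big_ord_recr.
rewrite !mxE !big_ord_recl !big_ord0 !mxE /=.
have -> : K.+1%:Z + j = K%:Z + j + 1 by lia.
have -> : lift ord0 ord0 = 1 :> 'I_2 by apply: val_inj.
have := us (K%:Z + j); rewrite /schroedingerR => /eqP.
rewrite -addrA addr_eq0 => /eqP uK; rewrite uK in IH1 IH2.
rewrite addrK; split; [rewrite IH1|rewrite IH2]; ring.
Qed.
End Monodromy.

(** * The trace dichotomy for periodic potentials *)

Section Periodic.
Context {R : realType} (v : int -> R) (K : nat) (K_gt0 : (0 < K)%N).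
Context (v_per : forall k : int, v (k + K%:Z) = v k).
Implicit Types (u w : int -> R).

(** A function that changes by at most e over a period, in either direction, grows
    at most linearly; for e = 0 this is the boundedness of periodic functions. Every
    integer is reached from the finitely many |k| <= K by steps of length K. *)
Lemma quasi_periodic_le (f : int -> R) (e : R) : 0 <= e ->
  (forall k, f (k + K%:Z) <= f k + e) -> (forall k, f (k - K%:Z) <= f k + e) ->
  exists A : R, forall k, f k <= A + e * `|k|%N%:R.
Proof.
move=> e0 fS fN; exists (\sum_(i < K.*2.+1) `|f (i%:Z - K%:Z)|) => k.
have [n kn] : exists n : nat, (`|k| < n)%N by exists `|k|%N.+1.
elim: n k kn => // n IH k; rewrite ltnS => kn.
have step (l : int) : (`|l| + K <= `|k|)%N -> f k <= f l + e ->
    f k <= \sum_(i < K.*2.+1) `|f (i%:Z - K%:Z)| + e * `|k|%N%:R.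
  move=> lk fkl; apply: le_trans fkl _; have {}IH := IH l ltac:(lia).
  apply: le_trans (lerD IH (lexx e)) _; rewrite -addrA lerD2l.
  rewrite -[X in _ + X]mulr1 -mulrDr natr1; apply: ler_wpM2l => //.
  by rewrite ler_nat; lia.
have [kK|Kk] := leqP `|k|%N K.
  have i_lt : (absz (k + K%:Z)%R < K.*2.+1)%N by lia.
  rewrite (bigD1 (Ordinal i_lt))//= (_ : (absz (k + K%:Z)%R)%:Z - K%:Z = k); last lia.
  rewrite -addrA; apply: le_trans (ler_norm _) _; rewrite lerDl addr_ge0//.
    exact: sumr_ge0.
  by rewrite mulr_ge0.
have [k0|k0] := leP 0 k.
  apply: (step (k - K%:Z)); first lia.
  by apply: le_trans (fS _); rewrite subrK.
apply: (step (k + K%:Z)); first lia.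
by apply: le_trans (fN _); rewrite addrK.
Qed.

Lemma periodic_bounded (f : int -> R) : (forall k, f (k + K%:Z) = f k) ->
  exists2 A : R, 0 < A & forall k, `|f k| <= A.
Proof.
move=> fK; have [|k|k|A fA] := @quasi_periodic_le (fun k => `|f k|) 0; rewrite ?addr0/=.
- by [].
- by rewrite fK.
- by rewrite -fK subrK.
exists (`|A| + 1) => [|k]; first by rewrite ltr_wpDl.
by have := fA k; rewrite /= mul0r addr0; have := ler_norm A; lra.
Qed.

Lemma periodic_lower_bound (f : int -> R) : (forall k, f (k + K%:Z) = f k) ->
  (forall k, 0 < f k) -> exists2 b : R, 0 < b & forall k, b <= f k.
Proof.
move=> fK f0; have [|A A0 fA] := @periodic_bounded (fun k => (f k)^-1).
  by move=> k; rewrite fK.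
exists A^-1 => [|k]; first by rewrite invr_gt0.
have := fA k; rewrite gtr0_norm ?invr_gt0// => fkA.
by rewrite -[f k]invrK lef_pV2// posrE// invr_gt0.
Qed.

Lemma solution_shift u : solution v u -> solution v (fun k => u (k + K%:Z)).
Proof.
move=> us k; have := us (k + K%:Z); rewrite /schroedingerR v_per.
by rewrite (addrAC k K%:Z (- 1)) (addrAC k K%:Z 1).
Qed.

Let t := \tr (monodromy v K 0).

Lemma mxtrace2 (M : 'M[R]_2) : \tr M = M 0 0 + M 1 1.
Proof.
rewrite /mxtrace !big_ord_recl big_ord0 addr0.
by have -> : lift ord0 ord0 = 1 :> 'I_2 by apply: val_inj.
Qed.

(** Cayley and Hamilton for the monodromy matrix M at 0, of determinant 1, show that
    the defect of this identity vanishes at 0 and at -1. The defect is itself a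
    solution, because translation by K preserves solutions, so it vanishes
    everywhere. *)
Lemma trace_recurrence u : solution v u ->
  forall k, u (k + K%:Z + K%:Z) = t * u (k + K%:Z) - u k.
Proof.
move=> us; pose z k := 1 * u (k + K%:Z + K%:Z) + 1 * (- t * u (k + K%:Z) + 1 * u k).
have us1 := solution_shift us; have us2 := solution_shift us1.
have zs : solution v z.
  by apply: solution_lin => //; exact: solution_lin.
suff z0 k : z k = 0.
  move=> k; have := z0 k; rewrite /z !mul1r => H.
  by apply/eqP; rewrite -subr_eq0 -[X in _ == X]H; apply/eqP; ring.
have := det_monodromy v K 0; rewrite det_mx2.
have [a1 b1] := monodromyE K 0 us; have [a2 b2] := monodromyE K 0 us1.
rewrite !addr0 !sub0r in a1 b1 a2 b2.
move: k; rewrite -/z; move=> k detM; move: k; apply: (@solution_eq0 _ v z 0) => //.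
  rewrite /z !add0r a2 add0r (_ : -1 + K%:Z = K%:Z - 1); last by clear; lia.
  rewrite b1 a1 /t mxtrace2.
  set m := monodromy v K 0 in detM *; set x := u 0; set y := u (-1).
  transitivity ((1 - (m 0 0 * m 1 1 - m 0 1 * m 1 0)) * x); first by ring.
  by rewrite detM subrr mul0r.
rewrite /z !sub0r (_ : -1 + K%:Z = K%:Z - 1) ?b2; last by clear; lia.
rewrite !add0r (_ : -1 + K%:Z = K%:Z - 1); last by clear; lia.
rewrite a1 b1 /t mxtrace2.
set m := monodromy v K 0 in detM *; set x := u 0; set y := u (-1).
transitivity ((1 - (m 0 0 * m 1 1 - m 0 1 * m 1 0)) * y); first by ring.
by rewrite detM subrr mul0r.
Qed.

(** The quadratic form E k = u (k + K)^2 - t u (k + K) u k + (u k)^2 is K-periodic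
    by the trace recurrence, hence bounded. For |t| <= 2 it dominates
    (|u (k + K)| - |u k|)^2, so |u| changes by a bounded amount over a period. The
    case |t| = 2 of a double eigenvalue is covered as well. *)
Lemma solution_linear_growth u : solution v u -> `|t| <= 2 ->
  exists A e : R, 0 <= e /\ forall k, `|u k| <= A + e * `|k|%N%:R.
Proof.
move=> us t2; pose E k := u (k + K%:Z) ^+ 2 - t * u (k + K%:Z) * u k + u k ^+ 2.
have [|A A0 EA] := @periodic_bounded E.
  by move=> k; rewrite /E trace_recurrence//; ring.
have step k : `| `|u (k + K%:Z)| - `|u k| | <= A + 1.
  have H : (`|u (k + K%:Z)| - `|u k|) ^+ 2 <= A.
    apply: le_trans (EA k); apply: le_trans (ler_norm _).
    rewrite /E sqrrB !real_normK ?num_real// lerD2r lerD2l lerN2.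
    apply: le_trans (ler_norm _) _.
    by rewrite !normrM -mulrA -mulr_natl ler_wpM2r.
  have : `| `|u (k + K%:Z)| - `|u k| | ^+ 2 <= A by rewrite real_normK ?num_real.
  by have := normr_ge0 (`|u (k + K%:Z)| - `|u k|); nra.
have A1 : 0 <= A + 1 by lra.
have [k|k|B uB] := @quasi_periodic_le (fun k => `|u k|) (A + 1) A1.
- by have := step k; rewrite ler_norml => /andP[_]; lra.
- by have := step (k - K%:Z); rewrite subrK ler_norml => /andP[]; lra.
- by exists B, (A + 1).
Qed.

(** The roots of X^2 - t X + 1 are real with product 1 and are distinct for
    |t| > 2; mu is the smaller one in absolute value. *)
Lemma exists_floquet_multiplier : 2 < `|t| ->
  exists mu : R, [/\ 0 < `|mu|, `|mu| < 1 & mu + mu^-1 = t].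
Proof.
move=> t2; pose s : R := Num.sqrt (`|t| ^+ 2 - 4).
have d0 : 0 < `|t| ^+ 2 - 4 by nra.
have s2 : s ^+ 2 = `|t| ^+ 2 - 4 by rewrite sqr_sqrtr// ltW.
have s0 : 0 < s by rewrite sqrtr_gt0.
pose m := (`|t| - s) / 2.
have m0 : 0 < m by rewrite /m; nra.
have m1 : m < 1 by rewrite /m; nra.
have mE : m + m^-1 = `|t|.
  have mm : m ^+ 2 - `|t| * m + 1 = 0 by rewrite /m; field: s2.
  have mn0 : m != 0 by rewrite gt_eqF.
  by apply: (mulfI mn0); rewrite mulrDr mulfV// -expr2; lra.
have [t0|t0] := leP 0 t.
  by exists m; rewrite gtr0_norm// mE ger0_norm.
exists (- m); rewrite normrN gtr0_norm// invrN -opprD mE ltr0_norm// opprK.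
by split.
Qed.

(** The solutions up and um decay at +oo and at -oo respectively, and grow at the
    other end. *)
Record floquet_pair (mu : R) (up um : int -> R) : Prop := FloquetPair {
  floquet_mu_neq0 : mu != 0;
  floquet_mu_lt1 : `|mu| < 1;
  floquet_solp : solution v up;
  floquet_solm : solution v um;
  floquet_perp : forall k, up (k + K%:Z) = mu * up k;
  floquet_perm : forall k, um (k + K%:Z) = mu^-1 * um k;
  floquet_wronskian : wronskian um up 0 != 0 }.

(** For any solution u, applying the factors of (S - mu)(S - 1/mu), S being the
    translation by K, yields the two Floquet solutions. They are independent when u
    and its translate are, that is, when (u 0, u (-1)) is not an eigenvector of the
    monodromy matrix M. Such a u exists: otherwise (1,0), (0,1) and (1,1) are all
    eigenvectors, M is scalar, and its determinant 1 contradicts |tr M| > 2. *)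
Lemma exists_floquet_pair : 2 < `|t| -> exists mu up um, floquet_pair mu up um.
Proof.
move=> t2; have [mu [mu0 mu1 muE]] := exists_floquet_multiplier t2.
have mu_neq0 : mu != 0 by rewrite -normr_gt0.
have [u us uW] : exists2 u, solution v u & u (K%:Z - 1) * u 0 - u K%:Z * u (-1) != 0.
  apply: contrapT => nex.
  (* The determinant of (a, b) and its image under M, a quadratic form in
     (a, b), vanishes exactly when (a, b) is an eigenvector. *)
  have Q a b : let M := monodromy v K 0 in
      M 1 0 * a ^+ 2 + (M 1 1 - M 0 0) * a * b - M 0 1 * b ^+ 2 = 0.
    move=> M; have [u [us ua ub]] := solution_exists v a b.
    have : u (K%:Z - 1) * u 0 - u K%:Z * u (-1) = 0.
      by apply/eqP; apply: contrapT => /negP uW; apply: nex; exists u.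
    have [] := monodromyE K 0 us; rewrite addr0 sub0r => -> ->.
    by rewrite ua ub -/M => <-; ring.
  have := Q 1 0; have := Q 0 1; have := Q 1 1 => /= Q11 Q01 Q10.
  have detM := det_monodromy v K 0; rewrite det_mx2 in detM.
  move: t2; rewrite /t mxtrace2.
  set M := monodromy v K 0 in Q11 Q01 Q10 detM *.
  have m10 : M 1 0 = 0 by lra.
  have m01 : M 0 1 = 0 by lra.
  have m11 : M 1 1 = M 0 0 by lra.
  rewrite m10 m11 in detM *.
  have : `|M 0 0 + M 0 0| ^+ 2 = 4.
    rewrite real_normK ?num_real//.
    by transitivity (4 * (M 0 0 * M 0 0 - M 0 1 * 0)); [ring|rewrite detM mulr1].
  by move=> H2 H3; nra.
pose us1 := solution_shift us.
have rec := trace_recurrence us.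
exists mu, (fun k => 1 * u (k + K%:Z) + (- mu^-1) * u k),
  (fun k => 1 * u (k + K%:Z) + (- mu) * u k).
split=> //; try exact: solution_lin.
- by move=> k; rewrite rec -muE; field.
- by move=> k; rewrite rec -muE; field.
have W0 : wronskian u (fun k => u (k + K%:Z)) 0 != 0.
  rewrite (wronskian_cst (v := v) 0 (-1))// /wronskian addNr add0r.
  rewrite (_ : -1 + K%:Z = K%:Z - 1); last by clear; lia.
  by rewrite -oppr_eq0 opprB (mulrC (u 0)) (mulrC (u (-1))).

rewrite (_ : wronskian _ _ 0 = (mu^-1 - mu) * wronskian u (fun k => u (k + K%:Z)) 0).
  rewrite mulf_neq0// subr_eq0; apply: contraTneq mu1 => mumu.
  have mm : mu * mu = 1 by rewrite -{1}mumu mulVf.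
  have : `|mu| * `|mu| = 1 by rewrite -normrM mm normr1.
  by move=> ?; rewrite -leNgt; nra.
by rewrite /wronskian; field.
Qed.
End Periodic.

(** * Floquet solutions and the test *)

Section PeriodicSets.
Context (K : nat) (K_gt0 : (0 < K)%N).

(** Transfers the tests, made for 0 <= j < K, to all integers. *)
Lemma periodic_forall (P : int -> Prop) : (forall k, P (k + K%:Z) <-> P k) ->
  (forall j : 'I_K, P j%:Z) -> forall k, P k.
Proof.
move=> PK Pj k; rewrite (divz_eq k K%:Z) addrC.
have k0 : 0 <= (k %% K)%Z by apply: modz_ge0; lia.
have k1 : (k %% K)%Z < K%:Z by apply: ltz_pmod; lia.
have iK : (absz (k %% K)%Z < K)%N by lia.
have := Pj (Ordinal iK); rewrite /= gez0_abs// => Pk.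
move: (k %/ K)%Z; apply: (int_shift_ind (j := 0)).
- by rewrite mul0r addr0.
- by move=> m Pm; rewrite mulrDl mul1r addrA; apply/PK.
- by move=> m Pm; apply/PK; rewrite mulrBl mul1r addrA subrK.
Qed.
End PeriodicSets.

Section QuasiPeriodic.
Context {R : realType} (K : nat) (K_gt0 : (0 < K)%N).
Context (f : int -> R) (nu rho : R) (rho0 : 0 < rho) (nuE : `|nu| = rho ^+ K).
Context (fK : forall k, f (k + K%:Z) = nu * f k).

Let g k := `|f k| / rho ^ k.

Let gK k : g (k + K%:Z) = g k.
Proof.
have rho_neq0 : rho != 0 by rewrite gt_eqF.
rewrite /g fK normrM nuE expfzDr// -exprnP.
have : rho ^ k != 0 by rewrite expfz_neq0.
have : rho ^+ K != 0 by rewrite expf_neq0.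
by move=> *; field; apply/andP; split.
Qed.

Lemma quasi_periodic_bound :
  exists2 A : R, 0 < A & forall k, `|f k| <= A * rho ^ k.
Proof.
have [A A0 gA] := periodic_bounded K_gt0 gK; exists A => // k.
have r0 : 0 < rho ^ k by rewrite exprz_gt0.
by rewrite -ler_pdivrMr//; apply: le_trans (gA k); exact: ler_norm.
Qed.

Lemma quasi_periodic_lower_bound : (forall k, f k != 0) ->
  exists2 b : R, 0 < b & forall k, b * rho ^ k <= `|f k|.
Proof.
move=> f0; have [k|b b0 gb] := periodic_lower_bound K_gt0 gK.
  by rewrite /g divr_gt0 ?normr_gt0// exprz_gt0.
by exists b => // k; rewrite -ler_pdivlMr ?exprz_gt0//; exact: gb.
Qed.
End QuasiPeriodic.

Section Floquet.
Context {R : realType} (v : int -> R) (K : nat) (K_gt0 : (0 < K)%N).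
Context (mu : R) (up um : int -> R) (fp : floquet_pair v K mu up um).

Let mu0 := floquet_mu_neq0 fp.
Let mu1 := floquet_mu_lt1 fp.

Lemma floquet_wronskian_neq0 k : wronskian um up k != 0.
Proof.
by rewrite (wronskian_cst _ 0 (floquet_solm fp) (floquet_solp fp)) (floquet_wronskian fp).
Qed.

Lemma floquet_up_next k : up k = 0 -> up (k + 1) != 0.
Proof.
have := floquet_wronskian_neq0 k; rewrite /wronskian => + uk.
by rewrite uk mulr0 subr0 mulf_eq0 negb_or => /andP[].
Qed.

Lemma floquet_um_next k : um (k + 1) = 0 -> um k != 0.
Proof.
have := floquet_wronskian_neq0 k; rewrite /wronskian => + uk.
by rewrite uk mul0r subr0 mulf_eq0 negb_or => /andP[].
Qed.

(** The test fails exactly when (1, 0) is an eigenvector for the contracting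
    eigenvalue mu: M 1 0 = 0 says that (1, 0) is an eigenvector, and |M 0 0| <= 1
    selects the eigenvalue. Here (a, b) and (c, d) span the two eigenspaces. *)
Lemma passes_test_eigen (M : 'M[R]_2) (a b c d : R) : a * d - b * c != 0 ->
  mu * a = M 0 0 * a + M 0 1 * b -> mu * b = M 1 0 * a + M 1 1 * b ->
  mu^-1 * c = M 0 0 * c + M 0 1 * d -> mu^-1 * d = M 1 0 * c + M 1 1 * d ->
  passes_test M = (b != 0).
Proof.
move=> W Ha Hb Hc Hd; rewrite /passes_test.
have [b0|b0] := eqVneq b 0.
  rewrite b0 mul0r subr0 mulf_eq0 negb_or in W; have [a0 _] := andP W.
  rewrite b0 !mulr0 addr0 in Ha Hb.
  have /eqP := esym Hb; rewrite addr0 mulf_eq0 (negbTE a0) orbF => /eqP ->.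
  by have /(mulIf a0) <- := Ha; rewrite eqxx /= ltNge ltW.
have [M10|//] := eqVneq (M 1 0) 0; rewrite /= M10 !mul0r !add0r in Hb Hd *.
have /(mulIf b0) M11 := Hb; rewrite -M11 in Hd.
have d0 : d = 0.
  apply: contraTeq mu1 => d0; have /(mulIf d0) mm := Hd.
  have m2 : mu * mu = 1 by rewrite -{1}mm mulVf.
  have : `|mu| * `|mu| = 1 by rewrite -normrM m2 normr1.
  by move=> ?; rewrite -leNgt; have := normr_ge0 mu; nra.
rewrite d0 mulr0 sub0r oppr_eq0 mulf_eq0 negb_or in W; have [_ c0] := andP W.
rewrite d0 mulr0 addr0 in Hc; have /(mulIf c0) <- := Hc.
by rewrite normfV invf_gt1 ?normr_gt0.
Qed.

(** Failure of the test at j means that the solution decaying at +oo satisfies the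
    Dirichlet condition at j - 1, the left neighbour of the half-line [j, +oo[. *)
Lemma passes_monodromy j : passes_test (monodromy v K j) = (up (j - 1) != 0).
Proof.
have [p1 p2] := monodromyE K j (floquet_solp fp).
have [m1 m2] := monodromyE K j (floquet_solm fp).
apply: (@passes_test_eigen _ (up j) _ (um j) (um (j - 1))).
- have := floquet_wronskian_neq0 (j - 1); rewrite /wronskian subrK.
  by rewrite (mulrC (um _)) (mulrC (um _)).
- by rewrite -p1 -(floquet_perp fp) addrC.
- by rewrite -p2 -(floquet_perp fp); congr up; clear; lia.
- by rewrite -m1 -(floquet_perm fp) addrC.
- by rewrite -m2 -(floquet_perm fp); congr um; clear; lia.
Qed.

Lemma floquet_upK k : (up (k + K%:Z) != 0) = (up k != 0).
Proof. by rewrite (floquet_perp fp) mulf_eq0 (negbTE mu0). Qed.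

Lemma floquet_umK k : (um (k + K%:Z) != 0) = (um k != 0).
Proof. by rewrite (floquet_perm fp) mulf_eq0 invr_eq0 (negbTE mu0). Qed.

(** The mirror image: failure means that the solution decaying at -oo vanishes at
    j, equivalently at the right neighbour j + K of a section ending at
    j + K - 1. *)
Lemma passes_monodromy_rev j : passes_test (monodromy_rev v K j) = (um j != 0).
Proof.
have [p1 p2] := monodromy_revE K j (floquet_solp fp).
have [m1 m2] := monodromy_revE K j (floquet_solm fp).
rewrite -floquet_umK addrC.
have Em k : um k = mu * um (k + K%:Z) by rewrite (floquet_perm fp) mulVKf.
have Ep k : up k = mu^-1 * up (k + K%:Z) by rewrite (floquet_perp fp) mulKf.
apply: (@passes_test_eigen _ (um (K%:Z + j - 1)) _ (up (K%:Z + j - 1)) (up (K%:Z + j))).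
- by have := floquet_wronskian_neq0 (K%:Z + j - 1); rewrite /wronskian subrK.
- by rewrite -m1 [RHS]Em; congr (_ * um _); clear; lia.
- by rewrite -m2 [RHS]Em; congr (_ * um _); clear; lia.
- by rewrite -p1 [RHS]Ep; congr (_ * up _); clear; lia.
- by rewrite -p2 [RHS]Ep; congr (_ * up _); clear; lia.
Qed.

Lemma floquet_up_neq0P : (forall k, up k != 0) <->
  (forall j : 'I_K, passes_test (monodromy v K j%:Z)).
Proof.
split=> [H j|H]; first by rewrite passes_monodromy.
suff H' k : up (k - 1) != 0 by move=> k; rewrite -(addrK 1 k).
move: k; apply: (periodic_forall K_gt0) => [k|j]; last by rewrite -passes_monodromy.
by rewrite addrAC floquet_upK.
Qed.

Lemma floquet_um_neq0P : (forall k, um k != 0) <->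
  (forall j : 'I_K, passes_test (monodromy_rev v K j%:Z)).
Proof.
split=> [H j|H]; first by rewrite passes_monodromy_rev.
apply: (periodic_forall K_gt0) => [k|j]; last by rewrite -passes_monodromy_rev.
by rewrite floquet_umK.
Qed.

(** The K-th root of |mu| is the decay per step. *)
Lemma exists_rate : exists2 r : R, 0 < r < 1 & `|mu| = r ^+ K.
Proof.
have m0 : 0 < `|mu| by rewrite normr_gt0.
exists (`|mu| `^ K%:R^-1).
  rewrite powR_gt0//=.
  have one : 1 `^ K%:R^-1 = 1 :> R by rewrite powR1.
  rewrite -[ltRHS]one; apply: gt0_ltr_powR; rewrite ?nnegrE//.
  by rewrite invr_gt0 ltr0n.
by rewrite -powR_mulrn ?powR_ge0// -powRrM mulVf ?powRr1// pnatr_eq0 -lt0n.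
Qed.

Lemma floquet_perp_iter m k : up (k + (m * K)%N%:Z) = mu ^+ m * up k.
Proof.
elim: m k => [|m IH] k; first by rewrite mul0n expr0 mul1r addr0.
have -> : k + (m.+1 * K)%N%:Z = k + (m * K)%N%:Z + K%:Z by clear; lia.
by rewrite (floquet_perp fp) IH exprS mulrA.
Qed.

Lemma floquet_perm_iter m k : um (k - (m * K)%N%:Z) = mu ^+ m * um k.
Proof.
elim: m k => [|m IH] k; first by rewrite mul0n expr0 mul1r subr0.
have := floquet_perm fp (k - (m.+1 * K)%N%:Z).
rewrite (_ : k - (m.+1 * K)%N%:Z + K%:Z = k - (m * K)%N%:Z); last by clear; lia.
rewrite IH.
by move=> H; rewrite exprS -mulrA H mulVKf.
Qed.

End Floquet.

(** * Green's function and summation kernels *)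

Section Green.
Context {R : realType} (v u w : int -> R).
Context (us : solution v u) (ws : solution v w).
Context (W_neq0 : wronskian u w 0 != 0).

Let W := wronskian u w 0.

(** Green's function of the solutions u and w: when u satisfies the boundary
    condition at the left end of an interval and w the one at the right end, it is
    the kernel of the inverse on that interval. The same formula serves the line,
    the half-line and the sections. *)
Definition green (i j : int) : R :=
  (if i <= j then u i * w j else u j * w i) / wronskian u w 0.

Lemma green_sym i j : green i j = green j i.
Proof. by rewrite /green; case: ltgtP => // ->. Qed.

(** Off the diagonal only one branch is involved, a multiple of a solution. On the
    diagonal the jump between the two branches is the Wronskian. *)
Lemma schroedingerR_green k j : schroedingerR v (fun i => green i j) k = (k == j)%:R.
Proof.
rewrite /schroedingerR /green -/W.
have gt_form i : j <= i -> (if i <= j then u i * w j else u j * w i) = u j * w i.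
  by case: ltgtP => // ->.
have [kj|jk|->] := ltgtP k j.
- rewrite !ifT; [|lia..].
  transitivity (schroedingerR v u k * w j / W); first by rewrite /schroedingerR; ring.
  by rewrite us !mul0r.
- rewrite !gt_form; [|lia..].
  transitivity (u j * schroedingerR v w k / W); first by rewrite /schroedingerR; ring.
  by rewrite ws mulr0 mul0r.
- rewrite [X in X / W + _]ifT; last lia.
  rewrite [X in _ + X / W + _]ifF; last lia.
  have WE : W = u j * w (j + 1) - u (j + 1) * w j.
    by rewrite -/(wronskian u w j) (wronskian_cst j 0 us ws).
  transitivity ((schroedingerR v u j * w j + (u j * w (j + 1) - u (j + 1) * w j)) / W).
    by rewrite /schroedingerR; ring.
  by rewrite us mul0r add0r -WE divff.
Qed.

(** Growth of u at the rate 1/r and decay of w at the rate r combine into decay off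
    the diagonal. The bounds are required at i and j only, since for a half-line or a
    section they hold only inside the interval. *)
Lemma green_bound (A B r : R) i j : 0 < r -> 0 <= A -> 0 <= B ->
  (forall k, k = i \/ k = j -> `|u k| <= A * r^-1 ^ k) ->
  (forall k, k = i \/ k = j -> `|w k| <= B * r ^ k) ->
  `|green i j| <= A * B / `|W| * r ^+ `|i - j|%N.
Proof.
move=> r0 A0 B0; wlog ij : i j / i <= j.
  move=> H uA wB; have [ij|/ltW ji] := leP i j; first exact: H.
  by rewrite green_sym distnC; apply: H => // k H; [apply: uA|apply: wB]; tauto.
move=> uA wB; rewrite /green ij normrM normfV mulrAC -/W.
rewrite ler_pM2r ?invr_gt0 ?normr_gt0// normrM.
apply: le_trans (ler_pM (normr_ge0 _) (normr_ge0 _) (uA i _) (wB j _)) _; [by left|by right|].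
rewrite mulrACA ler_wpM2l ?mulr_ge0// exprnP (_ : `|i - j|%N = j - i :> int); last lia.
by rewrite exprz_inv -expfzDr ?gt_eqF// addrC.
Qed.
End Green.

Section Kernel.
Context {R : realType} (r : R) (r01 : 0 < r < 1) (C : R) (g : int -> int -> R).
Context (gC : forall k j, `|g k j| <= C * r ^+ `|k - j|%N).
Implicit Types (f x y : int -> R).

Definition bounded_seq f := exists X : R, forall k, `|f k| <= X.

(** By the triangle inequality r ^ |k| r ^ |k - j| <= r ^ |j|. *)
Lemma exp_decay_kernel k x : bounded_seq x -> exp_decay r (fun j => g k j * x j).
Proof.
move=> [X xX]; have [r0 r1] := andP r01; exists (C * X / r ^+ `|k|%N) => j.
have C0 : 0 <= C.
  by have := gC 0 0; rewrite subrr expr0 mulr1; exact: le_trans.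
have X0 : 0 <= X by apply: le_trans (xX 0).
have rk : 0 < r ^+ `|k|%N by rewrite exprn_gt0.
rewrite normrM.
apply: le_trans (ler_pM (normr_ge0 _) (normr_ge0 _) (gC k j) (xX j)) _.
rewrite mulrAC -[leRHS]mulrA ler_wpM2l ?mulr_ge0// mulrC ler_pdivlMr//.
rewrite -exprD; apply: ler_wiXn2l; rewrite ?(ltW r0) ?(ltW r1)//; lia.
Qed.

Definition kernel_op x (k : int) : R := isum (fun j => g k j * x j).

Lemma kernel_opD (a : R) x y : bounded_seq x -> bounded_seq y ->
  kernel_op (fun j => a * x j + y j) = (fun k => a * kernel_op x k + kernel_op y k).
Proof.
move=> bx bb; apply/funext => k; rewrite /kernel_op -(isumD r01 a).
- by congr isum; apply/funext => j; ring.
- exact: exp_decay_kernel.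
- exact: exp_decay_kernel.
Qed.

(** The operator acts on a finite combination of sums, each of which can be
    evaluated termwise. *)
Lemma schroedingerR_kernel_op v x k : bounded_seq x ->
  (forall j, schroedingerR v (fun i => g i j) k * x j = (k == j)%:R * x j) ->
  schroedingerR v (kernel_op x) k = x k.
Proof.
move=> bx gk; rewrite /schroedingerR /kernel_op -[isum _ + isum _]addrC -[X in X + _ + _]mul1r.
have ed i := exp_decay_kernel i bx.
rewrite -(isumD r01)// addrC -(isumD r01)//; last exact: exp_decayD.
rewrite (@isum_delta _ _ k) => [|j jk].
  transitivity (schroedingerR v (fun i => g i k) k * x k); first by rewrite /schroedingerR; ring.
  by rewrite gk eqxx mul1r.
transitivity (schroedingerR v (fun i => g i j) k * x j); first by rewrite /schroedingerR; ring.
by rewrite gk eq_sym (negbTE jk) mul0r.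
Qed.

(** Discrete Green identity: with w j = g k j x (j + 1) - g k (j + 1) x j, the
    difference of g k j (H x) j and (H g k) j x j is w j - w (j - 1), which sums to
    0. The hypothesis is weighted by x so that it can fail where x vanishes, as
    happens just outside the half-line. *)
Lemma kernel_op_schroedingerR v x k : bounded_seq x ->
  (forall j, schroedingerR v (g k) j * x j = (k == j)%:R * x j) ->
  kernel_op (schroedingerR v x) k = x k.
Proof.
move=> bx gk; have [X xX] := bx.
have bx1 : bounded_seq (fun j => x (j + 1)) by exists X.
pose w j := -1 * (g k (j + 1) * x j) + g k j * x (j + 1).
have ew : exp_decay r w.
  apply: exp_decayD; last exact: exp_decay_kernel.
  have [r0 r1] := andP r01.
  have [D D0] := exp_decay_kernel k (x := fun j => x (j - 1)) ltac:(by exists X).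
  exists (D / r) => j; have := D0 (j + 1); rewrite addrK => /le_trans; apply.
  have D'0 : 0 <= D by have := D0 0; rewrite expr0 mulr1; exact: le_trans.
  rewrite -mulrA ler_wpM2l// ler_pdivlMl// -exprS.
  by apply: ler_wiXn2l; rewrite ?(ltW r0) ?(ltW r1)//; lia.
rewrite /kernel_op.
have -> : (fun j => g k j * schroedingerR v x j) =
    (fun j => 1 * (w j - w (j - 1)) + (k == j)%:R * x j).
  apply/funext => j; rewrite -gk /w subrK /schroedingerR; ring.
have ew1 : exp_decay r (fun j => w j - w (j - 1)).
  have [D D0] := ew; have [r0 r1] := andP r01; exists (D + D / r) => j.
  have D'0 : 0 <= D by have := D0 0; rewrite expr0 mulr1; exact: le_trans.
  apply: le_trans (ler_normB _ _) _; rewrite mulrDl; apply: lerD => //.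
  apply: le_trans (D0 _) _; rewrite -mulrA ler_wpM2l// ler_pdivlMl// -exprS.
  by apply: ler_wiXn2l; rewrite ?(ltW r0) ?(ltW r1)//; lia.
have ed : exp_decay r (fun j => (k == j)%:R * x j).
  exists (`|x k| / r ^+ `|k|%N) => j; have [r0 r1] := andP r01.
  have [<-|_] := eqVneq k j.
    by rewrite mul1r mulfVK// expf_neq0 ?gt_eqF.
  by rewrite mul0r normr0 mulr_ge0 ?divr_ge0// exprn_ge0 ?ltW.
rewrite (isumD r01)// (isum_telescope r01 ew) mulr0 add0r.
rewrite (@isum_delta _ _ k) ?eqxx ?mul1r// => j jk.
by rewrite eq_sym (negbTE jk) mul0r.
Qed.

End Kernel.

(** * Operators on complex sequences *)

Local Notation Re := complex.Re.
Local Notation Im := complex.Im.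
Section ComplexParts.
Context {R : realType}.
Implicit Types (z : R[i]).

Lemma normc_Re z : `|Re z| <= Normc.normc z.
Proof.
case: z => a b; rewrite /= -sqrtr_sqr; apply: ler_wsqrtr.
by rewrite lerDl sqr_ge0.
Qed.

Lemma normc_Im z : `|Im z| <= Normc.normc z.
Proof.
case: z => a b; rewrite /= -sqrtr_sqr; apply: ler_wsqrtr.
by rewrite lerDr sqr_ge0.
Qed.

Lemma normc_le_ReIm z : Normc.normc z <= `|Re z| + `|Im z|.
Proof.
case: z => a b /=; rewrite -[leRHS]ger0_norm ?addr_ge0// -sqrtr_sqr.
apply: ler_wsqrtr; rewrite sqrrD !real_normK ?num_real// addrAC lerDl.
by rewrite mulrn_wge0// mulr_ge0.
Qed.

Lemma normc_realM (a : R) z : Normc.normc (real_complex R a * z) = `|a| * Normc.normc z.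
Proof. by rewrite Normc.normcM normc_real. Qed.

Lemma ReM_real (a : R) z : Re (real_complex R a * z) = a * Re z.
Proof. by case: z => x y /=; rewrite mul0r subr0. Qed.

Lemma ImM_real (a : R) z : Im (real_complex R a * z) = a * Im z.
Proof. by case: z => x y /=; rewrite mul0r addr0. Qed.

Lemma complex_eq z z' : Re z = Re z' -> Im z = Im z' -> z = z'.
Proof. by case: z z' => [a b] [c d] /= -> ->. Qed.
End ComplexParts.

Section Discrete.
Context {d : measure_display} {T : measurableType d} {R : realType}.
Context (iota : T -> int) (iota_inj : injective iota).
Context (measurable_all : forall A : set T, measurable A).
Implicit Types (p : \bar R) (x y : T -> R[i]).

Lemma ellp_bounded p x : (1 <= p)%E -> ellp p x ->
  exists X : R, forall k, Normc.normc (x k) <= X.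
Proof.
rewrite /ellp /= => p1 xp; exists (fine (ellp_norm p x)) => k.
rewrite -lee_fin fineK; first exact: normc_le_ellp_norm.
by rewrite ge0_fin_numE// /ellp_norm Lnorm_ge0.
Qed.

(** A kernel bound gives at once the stability of l^p and the norm estimate. *)
Lemma bounded_operator_schur p (C r : R) (A : (T -> R[i]) -> T -> R[i]) :
  (1 <= p)%E -> 0 < C -> 0 < r < 1 ->
  (forall (a : R[i]) x y, ellp p x -> ellp p y ->
    A (fun k => a * x k + y k) = (fun k => a * A x k + A y k)) ->
  (forall x, ellp p x -> forall k, exists2 s, uniq s & Normc.normc (A x k) <=
     \sum_(j <- s) C * r ^+ `|iota k - iota j|%N * Normc.normc (x j)) ->
  bounded_operator p A.
Proof.
move=> p1 C0 r01 Alin Asch; split=> //.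
  move=> x xp; have := ellp_norm_schur iota_inj measurable_all p1 C0 r01 (Asch x xp).
  move=> /le_lt_trans; apply.
  have /fineK <- : ellp_norm p x \is a fin_num.
    by rewrite ge0_fin_numE// /ellp_norm Lnorm_ge0.
  by rewrite -EFinM ltry.
exists (C * (2 / (1 - r))) => x xp.
exact: (ellp_norm_schur iota_inj measurable_all p1 C0 r01 (Asch x xp)).
Qed.

(** The Schur test applied to a unit vector as input. *)
Lemma ellp_exp_decay p (D r : R) x k0 : (1 <= p)%E -> 0 < r < 1 ->
  (forall k, Normc.normc (x k) <= D * r ^+ `|iota k - iota k0|%N) -> ellp p x.
Proof.
move=> p1 r01 xD; have [r0 r1] := andP r01.
have D0 : 0 < `|D| + 1 by rewrite ltr_wpDl.
have H k : exists2 s, uniq s & Normc.normc (x k) <=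
     \sum_(j <- s) (`|D| + 1) * r ^+ `|iota k - iota j|%N * Normc.normc (unit_vector k0 j : R[i]).
  exists [:: k0] => //; rewrite big_seq1 /unit_vector eqxx Normc.normc1 mulr1.
  apply: le_trans (xD k) _; apply: ler_wpM2r; first by rewrite exprn_ge0// ltW.
  by have := ler_norm D; lra.
rewrite /ellp /=.
apply: le_lt_trans (ellp_norm_schur iota_inj measurable_all p1 D0 r01 H) _.
have := ellp_norm_unit iota_inj measurable_all k0 p1.
set e := ellp_norm _ _ => e1; apply: (@le_lt_trans _ _ (((`|D| + 1) * (2 / (1 - r)))%:E * 1)%E).
  by rewrite lee_pmul2l// lte_fin mulr_gt0// divr_gt0// subr_gt0.
by rewrite mule1 ltry.
Qed.

End Discrete.

Section KernelC.
Context {R : realType} (r : R) (r01 : 0 < r < 1) (C : R) (g : int -> int -> R).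
Context (gC : forall k j, `|g k j| <= C * r ^+ `|k - j|%N).
Implicit Types (x y : int -> R[i]).

Definition bounded_cseq x := exists X : R, forall k, Normc.normc (x k) <= X.

Let bRe x : bounded_cseq x -> bounded_seq (fun k => Re (x k)).
Proof. by move=> [X xX]; exists X => k; exact: le_trans (normc_Re _) _. Qed.

Let bIm x : bounded_cseq x -> bounded_seq (fun k => Im (x k)).
Proof. by move=> [X xX]; exists X => k; exact: le_trans (normc_Im _) _. Qed.

Definition kernel_opC x (k : int) : R[i] :=
  Complex (kernel_op g (fun j => Re (x j)) k) (kernel_op g (fun j => Im (x j)) k).

Lemma kernel_opC_lin (a : R[i]) x y : bounded_cseq x -> bounded_cseq y ->
  kernel_opC (fun j => a * x j + y j) = (fun k => a * kernel_opC x k + kernel_opC y k).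
Proof.
move=> bx bb; apply/funext => k.
have bRx := bRe bx; have bIx := bIm bx; have bRy := bRe bb; have bIy := bIm bb.
have bs (c : R) (f h : int -> R) : bounded_seq f -> bounded_seq h ->
    bounded_seq (fun j => c * f j + h j).
  move=> [X fX] [Y hY]; exists (`|c| * X + Y) => j.
  apply: le_trans (ler_normD _ _) _; rewrite normrM lerD//; exact: ler_wpM2l.
case: a => a b; rewrite /kernel_opC; apply: complex_eq => /=.
- rewrite (_ : (fun j => Re _) = (fun j => a * Re (x j) + (- b * Im (x j) + Re (y j)))).
    rewrite (kernel_opD r01 gC)//; last exact: bs.
    by rewrite (kernel_opD r01 gC)//; ring.
  by apply/funext => j; case: (x j) (y j) => [xa xb] [ya yb] /=; ring.
- rewrite (_ : (fun j => Im _) = (fun j => a * Im (x j) + (b * Re (x j) + Im (y j)))).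
    rewrite (kernel_opD r01 gC)//; last exact: bs.
    by rewrite (kernel_opD r01 gC)//; ring.
  by apply/funext => j; case: (x j) (y j) => [xa xb] [ya yb] /=; ring.
Qed.

Lemma Re_schroedinger v x k : Re (schroedinger v x k) = schroedingerR v (fun j => Re (x j)) k.
Proof. by rewrite /schroedinger !raddfD /= ReM_real. Qed.

Lemma Im_schroedinger v x k : Im (schroedinger v x k) = schroedingerR v (fun j => Im (x j)) k.
Proof. by rewrite /schroedinger !raddfD /= ImM_real. Qed.

Lemma schroedinger_kernel_opC v x k : bounded_cseq x ->
  (forall j, x j != 0 -> schroedingerR v (fun i => g i j) k = (k == j)%:R) ->
  schroedinger v (kernel_opC x) k = x k.
Proof.
move=> bx gk.
have H (h : R[i] -> R) j : h 0 = 0 ->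
    schroedingerR v (fun i => g i j) k * h (x j) = (k == j)%:R * h (x j).
  by move=> h0; have [->|/gk ->//] := eqVneq (x j) 0; rewrite h0 !mulr0.
apply: complex_eq; rewrite ?Re_schroedinger ?Im_schroedinger.
- by apply: (schroedingerR_kernel_op r01 gC (bRe bx)) => j; exact: (H (@complex.Re R)).
- by apply: (schroedingerR_kernel_op r01 gC (bIm bx)) => j; exact: (H (@complex.Im R)).
Qed.

Lemma kernel_opC_schroedinger v x k : bounded_cseq x ->
  (forall j, x j != 0 -> schroedingerR v (g k) j = (k == j)%:R) ->
  kernel_opC (schroedinger v x) k = x k.
Proof.
move=> bx gk.
have H (h : R[i] -> R) j : h 0 = 0 ->
    schroedingerR v (g k) j * h (x j) = (k == j)%:R * h (x j).
  by move=> h0; have [->|/gk ->//] := eqVneq (x j) 0; rewrite h0 !mulr0.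
apply: complex_eq => /=.
- rewrite (_ : (fun j => _) = schroedingerR v (fun j => Re (x j))); last first.
    by apply/funext => j; rewrite Re_schroedinger.
  by apply: (kernel_op_schroedingerR r01 gC (bRe bx)) => j; exact: (H (@complex.Re R)).
- rewrite (_ : (fun j => _) = schroedingerR v (fun j => Im (x j))); last first.
    by apply/funext => j; rewrite Im_schroedinger.
  by apply: (kernel_op_schroedingerR r01 gC (bIm bx)) => j; exact: (H (@complex.Im R)).
Qed.

(** Turns a convergent series into the finite domination required by the Schur
    test. *)
Lemma normc_kernel_opC x k : bounded_cseq x -> exists n,
  Normc.normc (kernel_opC x k) <=
  2 * partial_isum (fun j => `|g k j| * Normc.normc (x j)) n.
Proof.
move=> bx; set z := kernel_opC x k.
have [z0|z_neq0] := eqVneq (Normc.normc z) 0.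
  by exists 0%N; rewrite z0 /partial_isum big_geq ?mulr0.
have z0 : 0 < Normc.normc z by rewrite lt_neqAle eq_sym z_neq0 normc_ge0.
have cRe := isum_cvg r01 (exp_decay_kernel r01 gC k (bRe bx)).
have cIm := isum_cvg r01 (exp_decay_kernel r01 gC k (bIm bx)).
have e0 : 0 < Normc.normc z / 4 by rewrite divr_gt0.
(* A quarter for each of the real and imaginary parts: the partial sum then has
   at least half of the modulus. *)
have [n [nRe nIm]] : exists n,
    `|Re z - partial_isum (fun j => g k j * Re (x j)) n| < Normc.normc z / 4 /\
    `|Im z - partial_isum (fun j => g k j * Im (x j)) n| < Normc.normc z / 4.
  have /cvgr_dist_lt/(_ _ e0)[N1 _ HN1] := cRe.
  have /cvgr_dist_lt/(_ _ e0)[N2 _ HN2] := cIm.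
  exists (maxn N1 N2); split; [apply: HN1|apply: HN2].
    by rewrite /= leq_maxl.
  by rewrite /= leq_maxr.
exists n; pose P := \sum_(j <- window n) real_complex R (g k j) * x j.
have ReP : Re P = partial_isum (fun j => g k j * Re (x j)) n.
  by rewrite partial_isumE raddf_sum; apply: eq_bigr => j _; rewrite /= ReM_real.
have ImP : Im P = partial_isum (fun j => g k j * Im (x j)) n.
  by rewrite partial_isumE raddf_sum; apply: eq_bigr => j _; rewrite /= ImM_real.
have PS : Normc.normc P <= partial_isum (fun j => `|g k j| * Normc.normc (x j)) n.
  rewrite partial_isumE; apply: le_trans (normc_sum _ _) _.
  by apply: ler_sum => j _; rewrite normc_realM.
have zP : Normc.normc (z - P) <= Normc.normc z / 2.
  apply: le_trans (normc_le_ReIm _) _; rewrite !raddfB /= ReP ImP.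
  by move: nRe nIm; rewrite /=; lra.
have : Normc.normc z <= Normc.normc (z - P) + Normc.normc P.
  by rewrite -{1}(subrK P z); exact: le_normcD.
lra.
Qed.
End KernelC.

Section Bounded.
Context {R : realType} (v : int -> R) (V : R) (vV : forall k, `|v k| <= V).

Lemma schroedinger_lin (a : R[i]) x y :
  schroedinger v (fun k => a * x k + y k) =
  (fun k => a * schroedinger v x k + schroedinger v y k).
Proof. by apply/funext => k; rewrite /schroedinger; ring. Qed.

Lemma schroedinger_half_lin (a : R[i]) x y :
  schroedinger_half v (fun k => a * x k + y k) =
  (fun k => a * schroedinger_half v x k + schroedinger_half v y k).
Proof. by apply/funext => -[|k]; rewrite /schroedinger_half; ring. Qed.

Let halfr : 0 < (1 / 2 : R) < 1. Proof. lra. Qed.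

Let V0 : 0 <= V. Proof. by apply: le_trans (vV 0). Qed.

Lemma schroedinger_schur x k :
  Normc.normc (schroedinger v x k) <= \sum_(j <- [:: k - 1; k; k + 1])
    (2 * (V + 1)) * (1 / 2) ^+ `|k - j|%N * Normc.normc (x j).
Proof.
rewrite !big_cons big_nil (_ : absz (k - (k - 1))%R = 1%N); last lia.
rewrite (_ : absz (k - k)%R = 0%N); last lia.
rewrite (_ : absz (k - (k + 1))%R = 1%N); last lia.
rewrite /schroedinger expr0 expr1; apply: le_trans (le_normcD _ _) _.
apply: le_trans (lerD (le_normcD _ _) (lexx _)) _.
rewrite normc_realM.
have := normc_ge0 (x (k - 1)); have := normc_ge0 (x k); have := normc_ge0 (x (k + 1)).
set a := Normc.normc _; set b := Normc.normc _; set c := Normc.normc _ => a0 b0 c0.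
have := mulr_ge0 V0 a0; have := mulr_ge0 V0 b0; have := mulr_ge0 V0 c0.
have := ler_wpM2r b0 (vV k); lra.
Qed.

Lemma schroedinger_half_schur x k : exists2 s : seq nat, uniq s &
  Normc.normc (schroedinger_half v x k) <= \sum_(j <- s)
    (2 * (V + 1)) * (1 / 2) ^+ `|k%:Z - j%:Z|%N * Normc.normc (x j).
Proof.
have vb := ler_wpM2r (normc_ge0 (x k)) (vV k%:Z).
case: k vb => [|k] vb.
  exists [:: 0; 1]%N => //; rewrite !big_cons big_nil.
  rewrite (_ : absz (0%N%:Z - 0%N%:Z)%R = 0%N)// (_ : absz (0%N%:Z - 1%N%:Z)%R = 1%N)//.
  rewrite /schroedinger_half expr0 expr1 add0r; apply: le_trans (le_normcD _ _) _.
  rewrite normc_realM; move: vb.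
  have := normc_ge0 (x 0%N); have := normc_ge0 (x 1%N).
  set a := Normc.normc _; set b := Normc.normc _ => a0 b0.
  have := mulr_ge0 V0 a0; have := mulr_ge0 V0 b0; lra.
exists [:: k; k.+1; k.+2].
  by rewrite /= !inE; lia.
rewrite !big_cons big_nil (_ : absz (k.+1%:Z - k%:Z)%R = 1%N); last lia.
rewrite (_ : absz (k.+1%:Z - k.+1%:Z)%R = 0%N); last lia.
rewrite (_ : absz (k.+1%:Z - k.+2%:Z)%R = 1%N); last lia.
rewrite /schroedinger_half expr0 expr1; apply: le_trans (le_normcD _ _) _.
apply: le_trans (lerD (le_normcD _ _) (lexx _)) _.
rewrite normc_realM; move: vb.
have := normc_ge0 (x k); have := normc_ge0 (x k.+1); have := normc_ge0 (x k.+2).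
set a := Normc.normc _; set b := Normc.normc _; set c := Normc.normc _ => a0 b0 c0.
have := mulr_ge0 V0 a0; have := mulr_ge0 V0 b0; have := mulr_ge0 V0 c0; lra.
Qed.

Let C0 : 0 < 2 * (V + 1). Proof. by rewrite mulr_gt0// ltr_wpDl. Qed.

Lemma bounded_schroedinger (p : \bar R) : (1 <= p)%E ->
  bounded_operator p (schroedinger v).
Proof.
move=> p1; apply: (@bounded_operator_schur _ _ _ id _ _ _ _ _ _ p1 C0 halfr) => //.
  by move=> a x y _ _; exact: schroedinger_lin.
move=> x _ k; exists [:: k - 1; k; k + 1]; last exact: schroedinger_schur.
by rewrite /= !inE; lia.
Qed.

Lemma bounded_schroedinger_half (p : \bar R) : (1 <= p)%E ->
  bounded_operator p (schroedinger_half v).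
Proof.
move=> p1; apply: (@bounded_operator_schur _ _ _ Posz _ _ _ _ _ _ p1 C0 halfr) => //.
- by move=> ? ? [].
- by move=> a x y _ _; exact: schroedinger_half_lin.
- by move=> x _ k; exact: schroedinger_half_schur.
Qed.
End Bounded.

(** * Solutions adapted to the ends of an interval *)

Section Rates.
Context {R : realType} (v : int -> R) (K : nat) (K_gt0 : (0 < K)%N).
Context (mu : R) (up um : int -> R) (fp : floquet_pair v K mu up um).

Lemma exprz_decr (r : R) (m n : int) : 0 < r < 1 -> m <= n -> r ^ n <= r ^ m.
Proof.
move=> /andP[r0 r1] mn.
rewrite -[r]invrK.
rewrite !(exprz_inv r^-1); apply: ler_weXz2l; last by clear - mn; lia.
by rewrite invf_ge1// ltW.
Qed.

Definition decay_rates (r A : R) := [/\ 0 < r < 1, 0 < A, `|mu| = r ^+ K,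
  forall k, `|up k| <= A * r ^ k & forall k, `|um k| <= A * r^-1 ^ k].

Lemma exists_decay_rates : exists r A, decay_rates r A.
Proof.
have [r r01 muE] := exists_rate K_gt0 fp; have [r0 r1] := andP r01.
have ri0 : 0 < r^-1 by rewrite invr_gt0.
have [A A0 upA] := quasi_periodic_bound K_gt0 r0 muE (floquet_perp fp).
have [|B B0 umB] := @quasi_periodic_bound _ K K_gt0 um mu^-1 r^-1 ri0 _ (floquet_perm fp).
  by rewrite normfV muE exprVn.
exists r, (A + B); split => //; first by rewrite addr_gt0.
- move=> k; apply: le_trans (upA k) _; rewrite ler_wpM2r ?exprz_ge0 ?ltW//.
  by rewrite ltrDl.
- move=> k; apply: le_trans (umB k) _; rewrite ler_wpM2r ?exprz_ge0 ?ltW//.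
  by rewrite ltrDr.
Qed.

Context (r A : R) (rates : decay_rates r A).

Let r01 : 0 < r < 1. Proof. by case: rates. Qed.
Let r0 : 0 < r. Proof. by case/andP: r01. Qed.
Let rn0 : r != 0. Proof. by rewrite gt_eqF. Qed.
Let A0 : 0 < A. Proof. by case: rates. Qed.
Let upA k : `|up k| <= A * r ^ k. Proof. by case: rates. Qed.
Let umA k : `|um k| <= A * r^-1 ^ k. Proof. by case: rates. Qed.

Definition left_coef (a : int) := um a / up a.
Definition right_coef (c : int) := up c / um c.
(** The combination of um and up that vanishes at a. The correction involves the
    decaying solution up, so it does not spoil the growth of um to the right of a. *)
Definition left_solution (a : int) (k : int) := 1 * um k + (- left_coef a) * up k.
(** The mirror image: it vanishes at c and behaves like up to the left of c. *)
Definition right_solution (c : int) (k : int) := 1 * up k + (- right_coef c) * um k.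

Lemma left_solution_sol a : solution v (left_solution a).
Proof. by apply: solution_lin; [exact: floquet_solm fp|exact: floquet_solp fp]. Qed.

Lemma right_solution_sol c : solution v (right_solution c).
Proof. by apply: solution_lin; [exact: floquet_solp fp|exact: floquet_solm fp]. Qed.

Lemma left_solution0 a : up a != 0 -> left_solution a a = 0.
Proof. by move=> ua; rewrite /left_solution /left_coef; field. Qed.

Lemma right_solution0 c : um c != 0 -> right_solution c c = 0.
Proof. by move=> uc; rewrite /right_solution /right_coef; field. Qed.

Lemma left_coef_bound a b : 0 < b -> b * r ^ a <= `|up a| ->
  `|left_coef a| <= A / b * r ^ (- a - a).
Proof.
move=> b0 bu; rewrite /left_coef normrM normfV.
have ra0 : 0 < r ^ a by rewrite exprz_gt0.
have u0 : 0 < `|up a| by apply: lt_le_trans bu; rewrite mulr_gt0.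
rewrite ler_pdivrMr//; apply: le_trans (umA a) _.
rewrite expfzDr// exprz_inv; apply: (@le_trans _ _ (A / b * (r ^ (- a) * r ^ (- a)) * (b * r ^ a))).
  rewrite le_eqVlt; apply/orP; left; apply/eqP.
  rewrite -invr_expz.
  by field; rewrite !gt_eqF.
rewrite ler_wpM2l// !mulr_ge0 ?invr_ge0 ?exprz_ge0 ?ltW//.
Qed.

Lemma right_coef_bound c b : 0 < b -> b * r^-1 ^ c <= `|um c| ->
  `|right_coef c| <= A / b * r ^ (c + c).
Proof.
move=> b0 bu; rewrite /right_coef normrM normfV.
have ri0 : 0 < r^-1 by rewrite invr_gt0.
have rc0 : 0 < r ^ c by rewrite exprz_gt0.
have u0 : 0 < `|um c| by apply: lt_le_trans bu; rewrite mulr_gt0// exprz_gt0.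
rewrite ler_pdivrMr//; apply: le_trans (upA c) _.
rewrite expfzDr//; apply: (@le_trans _ _ (A / b * (r ^ c * r ^ c) * (b * r^-1 ^ c))).
  rewrite exprz_inv -invr_expz le_eqVlt; apply/orP; left; apply/eqP.
  by field; rewrite !gt_eqF.
by rewrite ler_wpM2l// !mulr_ge0 ?invr_ge0 ?exprz_ge0 ?ltW.
Qed.

(** The coefficient is of size r ^ (- 2 a) and up k of size r ^ k, and
    r ^ (k - 2 a) <= r ^ (- k) as soon as a <= k. The constant depends on b only, not
    on a. *)
Lemma left_solution_bound a b k : 0 < b -> b * r ^ a <= `|up a| -> a <= k ->
  `|left_solution a k| <= (A + A / b * A) * r^-1 ^ k.
Proof.
move=> b0 bu ak; rewrite /left_solution mul1r.
apply: le_trans (ler_normD _ _) _; rewrite mulrDl lerD// mulNr normrN normrM.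
apply: le_trans (ler_pM (normr_ge0 _) (normr_ge0 _) (left_coef_bound b0 bu) (upA k)) _.
rewrite mulrACA; apply: ler_wpM2l; first by rewrite !mulr_ge0 ?invr_ge0 ?ltW.
by rewrite -expfzDr// exprz_inv; apply: exprz_decr => //; clear - ak; lia.
Qed.

Lemma right_solution_bound c b k : 0 < b -> b * r^-1 ^ c <= `|um c| -> k <= c ->
  `|right_solution c k| <= (A + A / b * A) * r ^ k.
Proof.
move=> b0 bu kc; rewrite /right_solution mul1r.
apply: le_trans (ler_normD _ _) _; rewrite mulrDl lerD// mulNr normrN normrM.
apply: le_trans (ler_pM (normr_ge0 _) (normr_ge0 _) (right_coef_bound b0 bu) (umA k)) _.
rewrite mulrACA; apply: ler_wpM2l; first by rewrite !mulr_ge0 ?invr_ge0 ?ltW.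
by rewrite exprz_inv -expfzDr//; apply: exprz_decr => //; clear - kc; lia.
Qed.

Lemma wronskian_left_up a : wronskian (left_solution a) up 0 = wronskian um up 0.
Proof. by rewrite /wronskian /left_solution; ring. Qed.

(** The correction factor tends to 1 as the interval grows: the product of the two
    coefficients is of size r ^ (2 (c - a)). *)
Lemma wronskian_left_right a c : wronskian (left_solution a) (right_solution c) 0 =
  wronskian um up 0 * (1 - left_coef a * right_coef c).
Proof. by rewrite /wronskian /left_solution /right_solution; ring. Qed.

End Rates.

(** * Invertibility from Green's function *)

Section BoundedKernel.
Context {R : realType} (p : \bar R) (p1 : (1 <= p)%E).

Lemma ellp_bounded_cseq (x : int -> R[i]) : ellp p x -> bounded_cseq x.
Proof.
move=> xp; rewrite /bounded_cseq.
by apply: ellp_bounded p1 xp.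
Qed.

Lemma partial_isum_half (F : int -> R) n : (forall i, F (Negz i) = 0) ->
  partial_isum F n = \sum_(i <- index_iota 0 n) F i%:Z.
Proof. by move=> F0; apply: eq_bigr => i _; rewrite F0 addr0. Qed.

Lemma bounded_kernel_opC (r C : R) (g : int -> int -> R) : 0 < r < 1 -> 0 < C ->
  (forall k j, `|g k j| <= C * r ^+ `|k - j|%N) ->
  bounded_operator p (kernel_opC g).
Proof.
move=> r01 C0 gC.
have C20 : 0 < 2 * C by rewrite mulr_gt0.
apply: (@bounded_operator_schur _ _ _ id _ _ _ _ _ _ p1 C20 r01) => //.
- by move=> a x y xp yp; apply: (kernel_opC_lin r01 gC); exact: ellp_bounded_cseq.
move=> x xp k; have [n kn] := normc_kernel_opC r01 gC k (ellp_bounded_cseq xp).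
exists (window n); first exact: window_uniq.
apply: le_trans kn _; rewrite partial_isumE mulr_sumr; apply: ler_sum => j _.
by rewrite mulrA ler_wpM2r ?normc_ge0// -mulrA ler_wpM2l.
Qed.

End BoundedKernel.

Section HalfKernel.
Context {R : realType} (v : int -> R) (p : \bar R) (p1 : (1 <= p)%E).
Context (r C : R) (r01 : 0 < r < 1) (C0 : 0 < C) (g : int -> int -> R).
Context (gC : forall k j, `|g k j| <= C * r ^+ `|k - j|%N).
Context (g_sym : forall k j, g k j = g j k).
Context (g_supp : forall k j, k < 0 -> g k j = 0).
Context (g_schr : forall k j, 0 <= k -> 0 <= j ->
  schroedingerR v (fun i => g i j) k = (k == j)%:R).

Definition zero_ext (x : nat -> R[i]) (k : int) : R[i] :=
  match k with Posz n => x n | Negz _ => 0 end.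

Lemma schroedinger_zero_ext x n :
  schroedinger v (zero_ext x) n%:Z = schroedinger_half v x n.
Proof.
rewrite /schroedinger /schroedinger_half (_ : n%:Z + 1 = n.+1); last by clear; lia.
case: n => [//|n]; rewrite (_ : n.+1%:Z - 1 = n)//; clear; lia.
Qed.

Lemma bounded_zero_ext (x : nat -> R[i]) : ellp p x -> bounded_cseq (zero_ext x).
Proof.
move=> xp; have [X xX] : exists X : R, forall k, Normc.normc (x k) <= X.
  by apply: ellp_bounded p1 xp.
exists X => -[n|n]; first exact: xX.
by rewrite /zero_ext Normc.normc0; apply: le_trans (xX 0%N); exact: normc_ge0.
Qed.

(** The half-line is embedded into the line by zero, so that the summation theory
    over the integers applies unchanged. *)
Definition half_kernel_op (x : nat -> R[i]) (n : nat) : R[i] :=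
  kernel_opC g (zero_ext x) n%:Z.

Lemma bounded_half_kernel_op : bounded_operator p half_kernel_op.
Proof.
have C20 : 0 < 2 * C by rewrite mulr_gt0.
apply: (@bounded_operator_schur _ _ _ Posz _ _ _ _ _ _ p1 C20 r01) => //.
- by move=> ? ? [].
- move=> a x y xp yp; apply/funext => n; rewrite /half_kernel_op.
  rewrite (_ : zero_ext _ = fun k => a * zero_ext x k + zero_ext y k).
    by rewrite (kernel_opC_lin r01 gC)//; exact: bounded_zero_ext.
  by apply/funext => -[m|m] //=; rewrite mulr0 addr0.
- move=> x xp k.
  have [n kn] := normc_kernel_opC r01 gC k%:Z (bounded_zero_ext xp).
  exists (index_iota 0 n); first exact: iota_uniq.
  apply: le_trans kn _; rewrite partial_isum_half; last first.
    by move=> i; rewrite /zero_ext Normc.normc0 mulr0.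
  rewrite mulr_sumr; apply: ler_sum => j _.
  by rewrite mulrA ler_wpM2r ?normc_ge0// -mulrA ler_wpM2l.
Qed.

Lemma half_kernel_op_left x : ellp p x -> half_kernel_op (schroedinger_half v x) = x.
Proof.
move=> xp; apply/funext => n; rewrite -[RHS]/(zero_ext x n%:Z).
rewrite -(kernel_opC_schroedinger r01 gC (v := v) (k := n%:Z) (bounded_zero_ext xp)).
  rewrite /half_kernel_op /kernel_opC; congr Complex;
    congr isum; apply/funext => -[m|m];
    by [rewrite schroedinger_zero_ext|rewrite g_sym g_supp// !mul0r].
move=> [m|m]; last by rewrite /zero_ext eqxx.
move=> _; rewrite (_ : g n = fun i => g i n); first by rewrite g_schr// eq_sym.
by apply/funext => i; exact: g_sym.
Qed.

Lemma half_kernel_op_right x : ellp p x -> schroedinger_half v (half_kernel_op x) = x.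
Proof.
move=> xp; apply/funext => n; rewrite -[RHS]/(zero_ext x n%:Z).
rewrite -(schroedinger_kernel_opC r01 gC (v := v) (k := n%:Z) (bounded_zero_ext xp)); last first.
  by move=> [m|m]; [move=> _; rewrite g_schr|rewrite /zero_ext eqxx].
rewrite -schroedinger_zero_ext /schroedinger; congr (_ + _ + _).
case: n => [|n]; last by rewrite (_ : n.+1%:Z - 1 = n)//; clear; lia.
rewrite sub0r /zero_ext; apply: complex_eq => /=; rewrite /kernel_op;
  by rewrite (@isum_delta _ _ 0) => [|j _]; rewrite g_supp// mul0r.
Qed.
End HalfKernel.

Section Invertible.
Context {R : realType} (v : int -> R) (K : nat) (K_gt0 : (0 < K)%N).
Context (v_per : forall k : int, v (k + K%:Z) = v k).
Context (p : \bar R) (p1 : (1 <= p)%E).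
Context (mu : R) (up um : int -> R) (fp : floquet_pair v K mu up um).

Let sp := floquet_solp fp.
Let sm := floquet_solm fp.

Lemma schroedinger_invertible : invertible_operator p (schroedinger v).
Proof.
have [V V0 vV] := periodic_bounded K_gt0 v_per.
split; first (by apply (bounded_schroedinger vV p1)).
have [r [A [r01 A0 muE upA umA]]] := exists_decay_rates K_gt0 fp.
have [r0 r1] := andP r01.
have W0 := floquet_wronskian fp.
pose g := green um up.
pose C := A * A / `|wronskian um up 0|.
have C0 : 0 < C by rewrite !mulr_gt0// invr_gt0 normr_gt0.
have gC k j : `|g k j| <= C * r ^+ `|k - j|%N.
  by apply: green_bound => //; exact: ltW.
have gs k j : schroedingerR v (fun i => g i j) k = (k == j)%:R by exact: schroedingerR_green.
exists (kernel_opC g); split; first exact: bounded_kernel_opC gC.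
move=> x /(ellp_bounded_cseq p1) bx; split; apply/funext => k.
  apply: (kernel_opC_schroedinger r01 gC bx) => j _.
  rewrite (_ : g k = fun i => g i k); first by rewrite gs eq_sym.
  by apply/funext => i; exact: green_sym.
by apply: (schroedinger_kernel_opC r01 gC bx) => j _.
Qed.

(** Green's function for the Dirichlet condition at -1, cut off to nonnegative
    indices. The solution adapted to -1 exists because up does not vanish there. *)
Lemma schroedinger_half_invertible : up (-1) != 0 ->
  invertible_operator p (schroedinger_half v).
Proof.
move=> up1; have [V V0 vV] := periodic_bounded K_gt0 v_per.
split; first (by apply (bounded_schroedinger_half vV p1)).
have [r [A rates]] := exists_decay_rates K_gt0 fp.
have [r01 A0 muE upA umA] := rates.
have [r0 r1] := andP r01.
have up1' : 0 < `|up (-1)| by rewrite normr_gt0.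
pose u := left_solution up um (-1).
(* With a single end to control, the lower bound on up holds by choice of b. *)
pose b := `|up (-1)| / r ^ (-1).
have rr : 0 < r ^ (-1) by rewrite exprz_gt0.
have b0 : 0 < b by rewrite divr_gt0.
have bu : b * r ^ (-1) <= `|up (-1)| by rewrite divfK// gt_eqF.
have us : solution v u by apply: left_solution_sol fp _.
have u0 : u (-1) = 0 by exact: left_solution0.
pose B := A + A / b * A.
have B0 : 0 < B by rewrite addr_gt0// mulr_gt0// divr_gt0.
have uB k : -1 <= k -> `|u k| <= B * r^-1 ^ k by move=> k1; apply: (left_solution_bound rates b0 bu).
have Wu : wronskian u up 0 = wronskian um up 0 by exact: wronskian_left_up.
have W0 : wronskian u up 0 != 0 by rewrite Wu; exact: floquet_wronskian fp.
pose g k j := if (0 <= k) && (0 <= j) then green u up k j else 0.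
pose C := B * A / `|wronskian u up 0|.
have C0 : 0 < C by rewrite !mulr_gt0// invr_gt0 normr_gt0.
have gC k j : `|g k j| <= C * r ^+ `|k - j|%N.
  rewrite /g; case: ifPn => [/andP[k0 j0]|_].
    apply: green_bound => //; rewrite ?(ltW A0) ?(ltW B0)// => l lkj.
    by apply: uB; clear - lkj k0 j0; lia.
  by rewrite normr0 mulr_ge0 ?exprn_ge0 ?ltW.
(* At k = -1 the cut-off agrees with Green's function, which vanishes there; this
   is where the boundary condition enters. *)
have g_green k j : -1 <= k -> 0 <= j -> g k j = green u up k j.
  move=> k0 j0; rewrite /g j0 andbT; case: ifPn => // k0'.
  have -> : k = -1 by clear - k0 k0'; lia.
  by rewrite /green ifT ?u0 ?mul0r//; clear - j0; lia.
have gs k j : 0 <= k -> 0 <= j -> schroedingerR v (fun i => g i j) k = (k == j)%:R.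
  move=> k0 j0; rewrite -(schroedingerR_green us sp W0) /schroedingerR !g_green//; clear - k0; lia.
have g_sym k j : g k j = g j k by rewrite /g andbC green_sym.
have gsupp k j : k < 0 -> g k j = 0 by rewrite /g ltNge; case: (0 <= k).
exists (half_kernel_op g); split; first exact: bounded_half_kernel_op gC.
move=> x xp; split.
- exact: half_kernel_op_left gC g_sym gsupp gs _ xp.
- exact: half_kernel_op_right gC gsupp gs _ xp.
Qed.
End Invertible.

(** * Failure of invertibility *)

Section ApproxKernel.
Context {d : measure_display} {T : measurableType d} {R : realType}.
Context (iota : T -> int) (iota_inj : injective iota).
Context (measurable_all : forall A : set T, measurable A).
Context (p : \bar R) (p1 : (1 <= p)%E).

(** An invertible operator is bounded below, which excludes nonzero vectors x such
    that A x is dominated by a small multiple of neighbouring values of x. The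
    hypothesis is a kernel bound, so that it can be checked pointwise, for all p at
    once. *)
Lemma invertible_approx_kernel (A : (T -> R[i]) -> T -> R[i]) :
  invertible_operator p A -> exists2 e : R, 0 < e & forall x, ellp p x ->
    (forall k, exists2 s, uniq s & Normc.normc (A x k) <=
       \sum_(j <- s) (2 * e) * (1 / 2) ^+ `|iota k - iota j|%N * Normc.normc (x j)) ->
    forall k, x k = 0.
Proof.
move=> [[Ap _ _] [B [[_ _ [c Bc]] BA]]].
pose c' := `|c| + 1; have c0 : 0 < c' by rewrite ltr_wpDl.
(* The Schur constant of the hypothesis is 2 e * 2 / (1 - 1/2) = 8 e, so that
   16 c' leaves the contradiction |x| <= |x| / 2. *)
exists (16 * c')^-1 => [|x xp Ax k]; first by rewrite invr_gt0 mulr_gt0.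
set e := (16 * c')^-1 in Ax *.
have e0 : 0 < 2 * e by rewrite mulr_gt0// invr_gt0 mulr_gt0.
have half : 0 < (1 / 2 : R) < 1 by lra.
have H1 := ellp_norm_schur iota_inj measurable_all p1 e0 half Ax.
have H2 := Bc _ (Ap _ xp); rewrite (BA _ xp).1 in H2.
have nx : ellp_norm p x \is a fin_num.
  by rewrite ge0_fin_numE// /ellp_norm Lnorm_ge0.
have nA : ellp_norm p (A x) \is a fin_num.
  by rewrite ge0_fin_numE ?(Ap _ xp)// /ellp_norm Lnorm_ge0.
have nAge0 : (0 <= ellp_norm p (A x))%E by rewrite /ellp_norm Lnorm_ge0.
have : (Normc.normc (x k) <= fine (ellp_norm p x)).
  by rewrite -lee_fin fineK//; exact: normc_le_ellp_norm.
move: H1 H2 nAge0; rewrite -(fineK nx) -(fineK nA) -!EFinM !lee_fin /=.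
set X := fine (ellp_norm p x); set Y := fine _ => H1 H2 Y0 H3.
have cc : c <= c' by rewrite /c' (le_trans (ler_norm c))// lerDl.
have H4 : X <= c' * Y by apply: le_trans H2 _; exact: ler_wpM2r.
have ec : e * c' = 1 / 16 by rewrite /e; field; rewrite gt_eqF.
have H5 : c' * Y <= c' * (2 * e * (2 / (1 - 1 / 2)) * X) by rewrite ler_pM2l.
have H6 : c' * (2 * e * (2 / (1 - 1 / 2)) * X) = X / 2.
  transitivity ((e * c') * (2 * (2 / (1 - 1 / 2))) * X); first by ring.
  by rewrite ec; field.
apply: Normc.eq0_normc; apply/eqP; rewrite eq_le normc_ge0 andbT.
rewrite H6 in H5; lra.
Qed.
End ApproxKernel.

Section NotInvertible.
Context {R : realType}.

Lemma mulrn_geometric_le (s : R) n : 0 <= s < 1 -> n%:R * s ^+ n <= (1 - s)^-1.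
Proof.
move=> /andP[s0 s1]; have s1' : 0 < 1 - s by lra.
rewrite -[leRHS]mul1r ler_pdivlMr//.
suff : n%:R * s ^+ n * (1 - s) <= 1 - s ^+ n.
  by move=> /le_trans; apply; rewrite gerBl exprn_ge0.
elim: n => [|n IH]; first by rewrite expr0 subrr !mul0r.
rewrite exprS -natr1; have sn0 : 0 <= s ^+ n by rewrite exprn_ge0.
have H1 := ler_wpM2l s0 IH; have H2 : s ^+ n <= 1 by rewrite exprn_ile1// ltW.
have H3 := mulr_ge0 s0 sn0.
have H4 : 0 <= (1 - s) * (1 - s * s ^+ n).
  by rewrite mulr_ge0 ?subr_ge0 ?mulr_ile1// ltW.
set S := s ^+ n in H1 H2 H3 H4 *; set N := n%:R in H1 *.
lra.
Qed.

Context (v : int -> R) (K : nat) (K_gt0 : (0 < K)%N).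
Context (v_per : forall k : int, v (k + K%:Z) = v k).
Context (p : \bar R) (p1 : (1 <= p)%E).

Section Damped.
Context (u : int -> R) (us : solution v u) (e : R) (e0 : 0 < e).

Let q := (1 + e)^-1.

Let q0 : 0 < q. Proof. by rewrite invr_gt0 addr_gt0. Qed.
Let q1 : q < 1. Proof. by rewrite invf_lt1 ?ltrDl// addr_gt0. Qed.
Let qe : q * (1 + e) = 1. Proof. by rewrite mulVf// gt_eqF// addr_gt0. Qed.

(** The parameter e = 1 / q - 1 is the relative increment of the damping factor
    q ^ |k|. *)
Definition damped (k : int) : R := q ^+ `|k|%N * u k.

Let q_step (m n : nat) : (m <= n.+1)%N -> (n <= m.+1)%N ->
  `|q ^+ m - q ^+ n| <= e * q ^+ m.
Proof.
move=> mn nm; have [->|[->|->]] : m = n \/ m = n.+1 \/ n = m.+1.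
  by clear - mn nm; lia.
- by rewrite subrr normr0 mulr_ge0 ?exprn_ge0 ?ltW.
- have qn : 0 < q ^+ n by rewrite exprn_gt0.
  rewrite exprS distrC ger0_norm; last by rewrite subr_ge0 ger_pMl// ltW.
  rewrite mulrA (_ : e * q = 1 - q) ?mulrBl ?mul1r//.
  by rewrite -qe; ring.
- have qn : 0 < q ^+ m by rewrite exprn_gt0.
  rewrite exprS ger0_norm; last by rewrite subr_ge0 ger_pMl// ltW.
  rewrite -[X in X - _]mul1r -mulrBl ler_pM2r// -{1}qe mulrDr mulr1 addrC addKr.
  by rewrite ger_pMl// ltW.
Qed.

(** Since q u is a solution for constant q, only the increments of q ^ |k| remain,
    and neighbouring values of q ^ |k| have ratio at most 1 + e. *)
Lemma schroedingerR_damped k : `|schroedingerR v damped k| <=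
  e * `|damped (k - 1)| + e * `|damped (k + 1)|.
Proof.
have -> : schroedingerR v damped k = (q ^+ absz (k - 1)%R - q ^+ `|k|%N) * u (k - 1) +
    (q ^+ absz (k + 1)%R - q ^+ `|k|%N) * u (k + 1).
  rewrite -[RHS]addr0 -(mulr0 (q ^+ `|k|%N)) -(us k) /schroedingerR /damped; ring.
apply: le_trans (ler_normD _ _) _; rewrite /damped !normrM.
have nq n : `|q ^+ n| = q ^+ n by rewrite ger0_norm// exprn_ge0// ltW.
rewrite !nq !mulrA.
by apply: lerD; apply: ler_wpM2r => //; apply: q_step; clear; lia.
Qed.

(** Exponential damping beats linear growth; r is any number strictly between q
    and 1. *)
Lemma damped_decay : `|\tr (monodromy v K 0)| <= 2 ->
  exists r D : R, 0 < r < 1 /\ forall k, `|damped k| <= D * r ^+ `|k|%N.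
Proof.
move=> t2; have [A [B [B0 uB]]] := solution_linear_growth K_gt0 v_per us t2.
(* The part s = q / r of the damping absorbs the linear growth, r is left for the
   decay. *)
pose r := (1 + q) / 2; pose s := q / r.
have r01 : 0 < r < 1 by rewrite /r; have := q0; have := q1; lra.
have [r0 r1] := andP r01.
have s01 : 0 <= s < 1.
  rewrite divr_ge0 ?(ltW q0) ?(ltW r0)//= ltr_pdivrMr// mul1r /r.
  by have := q0; have := q1; lra.
have [s0 s1] := andP s01.
exists r, (`|A| + B * (1 - s)^-1); split => // k.
have -> : damped k = r ^+ `|k|%N * (s ^+ `|k|%N * u k).
  by rewrite /damped mulrA -exprMn /s mulrCA mulfV ?gt_eqF// mulr1.
rewrite normrM mulrC [X in _ * X]ger0_norm ?exprn_ge0 ?(ltW r0)//.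
apply: ler_wpM2r; first by rewrite exprn_ge0// ltW.
rewrite normrM ger0_norm ?exprn_ge0//.
apply: le_trans (ler_wpM2l _ (uB k)) _; first by rewrite exprn_ge0.
rewrite mulrDr; apply: lerD.
  apply: le_trans (ler_wpM2l _ (ler_norm A)) _; first by rewrite exprn_ge0.
  by rewrite ler_piMl// exprn_ile1// ltW.
by rewrite mulrCA ler_wpM2l// mulrC; exact: mulrn_geometric_le.
Qed.
End Damped.

Lemma schroedinger_of_real (X : int -> R) k :
  schroedinger v (fun j => real_complex R (X j)) k = real_complex R (schroedingerR v X k).
Proof.
apply: complex_eq; rewrite ?Re_schroedinger ?Im_schroedinger//=.
by rewrite /schroedingerR !mulr0 !addr0.
Qed.

Lemma schroedinger_not_invertible : `|\tr (monodromy v K 0)| <= 2 ->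
  ~ invertible_operator p (schroedinger v).
Proof.
move=> t2 inv.
have [|//|e e0 H] := @invertible_approx_kernel _ _ _ id _ _ p p1 _ inv.
  exact: inj_id.
have [u [us u0 _]] := solution_exists v 1 0.
have [r [D [r01 uD]]] := damped_decay us e0 t2.
pose x k := real_complex R (damped u e k).
have : x 0 = 0.
  apply: H => [|k].
    apply: (@ellp_exp_decay _ _ _ id _ _ p D r x 0 p1 r01) => // k.
    by rewrite /x normc_real subr0.
  exists [:: k - 1; k + 1]; first by rewrite /= !inE; clear; lia.
  rewrite !big_cons big_nil addr0 /x !normc_real.
  rewrite (_ : absz (k - (k - 1))%R = 1%N); last by clear; lia.
  rewrite (_ : absz (k - (k + 1))%R = 1%N); last by clear; lia.
  rewrite (_ : 2 * e * (1 / 2) ^+ 1 = e); last by field.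
  have -> : schroedinger v x k = real_complex R (schroedingerR v (damped u e) k).
    exact: schroedinger_of_real.
  by rewrite normc_real; exact: schroedingerR_damped.
move=> /(congr1 (@complex.Re R)); rewrite /x /damped /= u0 expr0 mulr1.
by move/eqP; rewrite oner_eq0.
Qed.

Lemma schroedinger_half_of_real (X : int -> R) n : X (-1) = 0 ->
  schroedinger_half v (fun n => real_complex R (X n%:Z)) n =
  real_complex R (schroedingerR v X n%:Z).
Proof.
move=> X0; rewrite -schroedinger_of_real /schroedinger_half /schroedinger.
rewrite (_ : n%:Z + 1 = n.+1); last by clear; lia.
case: n => [|n]; first by rewrite sub0r X0.
by rewrite (_ : n.+1%:Z - 1 = n)//; clear; lia.
Qed.

(** The damped solution with u (-1) = 0 satisfies the boundary condition exactly,
    so restricting it to the half-line produces no boundary error. *)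
Lemma schroedinger_half_not_invertible : `|\tr (monodromy v K 0)| <= 2 ->
  ~ invertible_operator p (schroedinger_half v).
Proof.
move=> t2 inv.
have [||e e0 H] := @invertible_approx_kernel _ _ _ Posz _ _ p p1 _ inv => //.
  by move=> ? ? [].
have [u [us u0 u1]] := solution_exists v 1 0.
have [r [D [r01 uD]]] := damped_decay us e0 t2.
pose x n := real_complex R (damped u e n%:Z).
have d1 : damped u e (-1) = 0 by rewrite /damped u1 mulr0.
have : x 0%N = 0.
  apply: H => [|k].
    apply: (@ellp_exp_decay _ _ _ Posz _ _ p D r x 0%N p1 r01) => //.
      by move=> ? ? [].
    by move=> k; rewrite /x normc_real subr0.
  rewrite schroedinger_half_of_real// normc_real.
  have := schroedingerR_damped us e0 k; case: k => [|k] H'.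
    move: H'; rewrite sub0r d1 normr0 mulr0 add0r => uk; exists [:: 1%N] => //.
    by rewrite big_seq1 normc_real (_ : 2 * e * (1 / 2) ^+ _ = e) //=; field.
  exists [:: k; k.+2]; first by rewrite /= !inE; clear; lia.
  rewrite !big_cons big_nil addr0 /x !normc_real.
  rewrite (_ : absz (k.+1%:Z - k%:Z)%R = 1%N); last by clear; lia.
  rewrite (_ : absz (k.+1%:Z - k.+2%:Z)%R = 1%N); last by clear; lia.
  rewrite (_ : 2 * e * (1 / 2) ^+ 1 = e); last by field.
  have Em : k.+1%:Z - 1 = k by clear; lia.
  have Ep : k.+1%:Z + 1 = k.+2 by clear; lia.
  by rewrite Em Ep in H'.
move=> /(congr1 (@complex.Re R)); rewrite /x /damped /= u0 expr0 mulr1.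
by move/eqP; rewrite oner_eq0.
Qed.

(** If up (-1) = 0, then up restricted to the half-line lies in every l^p and in
    the kernel. *)
Lemma schroedinger_half_invertible_up mu up um : floquet_pair v K mu up um ->
  invertible_operator p (schroedinger_half v) -> up (-1) != 0.
Proof.
move=> fp inv; apply/negP => /eqP up1.
have [||e e0 H] := @invertible_approx_kernel _ _ _ Posz _ _ p p1 _ inv => //.
  by move=> ? ? [].
have [r [A [r01 A0 muE upA umA]]] := exists_decay_rates K_gt0 fp.
pose x n := real_complex R (up n%:Z).
have : x 0%N = 0.
  apply: H => [|k].
    apply: (@ellp_exp_decay _ _ _ Posz _ _ p A r x 0%N p1 r01) => //.
      by move=> ? ? [].
    by move=> k; rewrite /x normc_real subr0.
  exists [::] => //.
  by rewrite schroedinger_half_of_real// (floquet_solp fp) normc_real normr0 big_nil.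
move=> /(congr1 (@complex.Re R)); rewrite /x /= => u0.
have := floquet_up_next fp up1.
by rewrite addNr u0 eqxx.
Qed.
End NotInvertible.

(** * Finite sections *)

Section Jacobi.
Context {R : realType} (v : int -> R).

(** The section over {a, ..., a + N}, as a real matrix: sections of the line and of
    the half-line differ only in a. *)
Definition jacobi (a : int) (N : nat) : 'M[R]_N.+1 :=
  \matrix_(i, j) ((i == j.+1 :> nat)%:R + (j == i.+1 :> nat)%:R
                  + v (a + i%:Z) * (i == j)%:R).

Lemma section_windowZ n :
  section_mx (windowZ n) (schroedinger v) =
  map_mx (real_complex R) (jacobi (- n%:Z) n.*2).
Proof.
apply/matrixP => i j; rewrite !mxE /schroedinger /unit_vector /windowZ.
rewrite !(rmorphD, rmorphM, rmorph_nat) (addrC (- n%:Z)).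
congr (_ %:R + _ %:R + _ * _ %:R)%R.
- by congr nat_of_bool; apply/eqP/eqP; clear; lia.
- by congr nat_of_bool; apply/eqP/eqP; clear; lia.
- congr nat_of_bool; apply/eqP/eqP => [H|->//]; apply: val_inj => /=.
  by clear - H; lia.
Qed.

Lemma section_windowN n :
  section_mx (windowN n) (schroedinger_half v) =
  map_mx (real_complex R) (jacobi 0 n).
Proof.
apply/matrixP => i j; rewrite !mxE /schroedinger_half /unit_vector /windowN.
rewrite !(rmorphD, rmorphM, rmorph_nat) add0r.
congr (_ + _ %:R + _ * _ %:R)%R.
- by case: (nat_of_ord i) => [|m]; [rewrite eq_sym|rewrite eqSS].
- by rewrite eq_sym.
Qed.

Lemma sum_ord_delta (N m : nat) (f : nat -> R) :
  \sum_(j < N) (m == j :> nat)%:R * f j = if (m < N)%N then f m else 0.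
Proof.
transitivity (\sum_(j < N | j == m :> nat) f j); last by rewrite big_ord1_eq.
rewrite [RHS]big_mkcond; apply: eq_bigr => j _.
by rewrite eq_sym; case: eqP => _; rewrite ?mul1r ?mul0r.
Qed.

(** A section acts on a restricted sequence like the operator, except for the two
    neighbours that it does not see. *)
Lemma jacobi_mulmx a N (x : int -> R) (i : 'I_N.+1) :
  \sum_j jacobi a N i j * x (a + j%:Z) = schroedingerR v x (a + i%:Z)
    - (i == 0 :> nat)%:R * x (a - 1) - (i == N :> nat)%:R * x (a + N%:Z + 1).
Proof.
under eq_bigr do rewrite mxE 2!mulrDl.
rewrite !big_split /=; pose f (m : nat) := x (a + m%:Z).
have -> : \sum_(j < N.+1) (i == j.+1 :> nat)%:R * x (a + j%:Z) =
    x (a + i%:Z - 1) - (i == 0 :> nat)%:R * x (a - 1).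
  case: i => [[|m] mN] /=.
    rewrite mul1r big1 => [|j _]; last by rewrite mul0r.
    by rewrite addr0 subrr.
  under eq_bigr do rewrite eqSS.
  rewrite (sum_ord_delta _ _ f) mul0r subr0 ifT; last by rewrite (ltn_trans _ mN).
  by congr x; clear; lia.
have -> : \sum_(j < N.+1) (j == i.+1 :> nat)%:R * x (a + j%:Z) =
    x (a + i%:Z + 1) - (i == N :> nat)%:R * x (a + N%:Z + 1).
  under eq_bigr do rewrite eq_sym.
  rewrite (sum_ord_delta _ _ f) ltnS /f; case: (eqVneq (nat_of_ord i) N) => [->|iN].
    by rewrite ltnn mul1r subrr.
  have iN1 := ltn_ord i; rewrite ltnS leq_eqVlt (negbTE iN) /= in iN1.
  by rewrite iN1 mul0r subr0; congr x; clear; lia.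
have -> : \sum_(j < N.+1) v (a + i%:Z) * (i == j)%:R * x (a + j%:Z) =
    v (a + i%:Z) * x (a + i%:Z).
  rewrite (bigD1 i)//= eqxx mulr1 big1 ?addr0// => j ji.
  by rewrite eq_sym (negbTE ji) mulr0 mul0r.
by rewrite /schroedingerR; ring.
Qed.

(** Green's function has no boundary terms: as a function of its first argument it
    vanishes at both neighbours of the section. *)
Lemma jacobi_green a N u w : solution v u -> solution v w ->
  wronskian u w 0 != 0 -> u (a - 1) = 0 -> w (a + N%:Z + 1) = 0 ->
  jacobi a N \in unitmx /\
  forall i j, invmx (jacobi a N) i j = green u w (a + i%:Z) (a + j%:Z).
Proof.
move=> us ws W0 ua wb.
pose G : 'M[R]_N.+1 := \matrix_(i, j) green u w (a + i%:Z) (a + j%:Z).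
have JG : jacobi a N *m G = 1%:M.
  apply/matrixP => i j; rewrite mxE [RHS]mxE.
  under eq_bigr do rewrite [G _ _]mxE.
  rewrite (jacobi_mulmx _ (fun k => green u w k (a + j%:Z))) schroedingerR_green//.
  have -> : green u w (a - 1) (a + j%:Z) = 0.
    by rewrite /green ifT ?ua ?mul0r//; clear; lia.
  have -> : green u w (a + N%:Z + 1) (a + j%:Z) = 0.
    have jN := ltn_ord j.
    by rewrite /green ifF ?wb ?mulr0 ?mul0r//; apply/negbTE; clear - jN; lia.
  rewrite !mulr0 !subr0; congr (nat_of_bool _)%:R.
  by apply/eqP/eqP => [H|->//]; apply: val_inj => /=; clear - H; lia.
have [Ju _] := mulmx1_unit JG; split => // i j.
by rewrite -[invmx _]mulmx1 -JG mulKmx// mxE.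
Qed.

(** If u vanishes at the left neighbour, the section maps it to a multiple of the
    last unit vector, so one entry of the inverse compares both ends of u. *)
Lemma jacobi_unit_left a N u c : jacobi a N \in unitmx ->
  (forall i j, `|invmx (jacobi a N) i j| <= c) ->
  solution v u -> u (a - 1) = 0 -> `|u a| <= c * `|u (a + N%:Z + 1)|.
Proof.
move=> Ju Jc us ua.
pose U : 'cV[R]_N.+1 := \col_i u (a + i%:Z).
have JU i : (jacobi a N *m U) i 0 = - ((i == ord_max)%:R * u (a + N%:Z + 1)).
  rewrite mxE; under eq_bigr do rewrite [U _ _]mxE.
  by rewrite jacobi_mulmx us ua mulr0 subr0 sub0r.
have : U ord0 0 = - (invmx (jacobi a N) ord0 ord_max * u (a + N%:Z + 1)).
  rewrite -[U](mulKmx Ju) mxE (bigD1 ord_max)//= JU eqxx mul1r mulrN.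
  by rewrite big1 ?addr0// => i iN; rewrite JU (negbTE iN) mul0r oppr0 mulr0.
rewrite mxE addr0 => ->; rewrite normrN normrM.
by apply: ler_wpM2r.
Qed.

Lemma jacobi_unit_right a N u c : jacobi a N \in unitmx ->
  (forall i j, `|invmx (jacobi a N) i j| <= c) ->
  solution v u -> u (a + N%:Z + 1) = 0 -> `|u (a + N%:Z)| <= c * `|u (a - 1)|.
Proof.
move=> Ju Jc us ua.
pose U : 'cV[R]_N.+1 := \col_i u (a + i%:Z).
have JU i : (jacobi a N *m U) i 0 = - ((i == ord0)%:R * u (a - 1)).
  rewrite mxE; under eq_bigr do rewrite [U _ _]mxE.
  by rewrite jacobi_mulmx us ua mulr0 subr0 sub0r.
have : U ord_max 0 = - (invmx (jacobi a N) ord_max ord0 * u (a - 1)).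
  rewrite -[U](mulKmx Ju) mxE (bigD1 ord0)//= JU eqxx mul1r mulrN.
  by rewrite big1 ?addr0// => i iN; rewrite JU (negbTE iN) mul0r oppr0 mulr0.
rewrite mxE => ->; rewrite normrN normrM.
by apply: ler_wpM2r.
Qed.
End Jacobi.

Section Opnorm.
Context {R : realType} (p : \bar R) (p1 : (1 <= p)%E).

Let ord_int m : 'I_m.+1 -> int := fun i => i%:Z.
Let ord_int_inj m : injective (@ord_int m).
Proof. by move=> i j [] /val_inj. Qed.

(** The Schur test gives a bound independent of the size of the matrix. *)
Lemma ellp_opnorm_le m (M : 'M[R]_m.+1) (C r : R) : 0 < C -> 0 < r < 1 ->
  (forall i j, `|M i j| <= C * r ^+ `|i%:Z - j%:Z|%N) ->
  (ellp_opnorm p (map_mx (real_complex R) M) <= (C * (2 / (1 - r)))%:E)%E.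
Proof.
move=> C0 r01 MC; apply: ge_ereal_sup => _ [u /= u1 <-].
have cr0 : 0 <= C * (2 / (1 - r)).
  by have [r0 r1] := andP r01; rewrite mulr_ge0 ?divr_ge0 ?subr_ge0// ltW.
apply: (@le_trans _ _ ((C * (2 / (1 - r)))%:E * ellp_norm p (fun i => u i 0%R))%E).
  apply: (ellp_norm_schur (@ord_int_inj m)) => // k.
  exists (index_enum 'I_m.+1); first exact: index_enum_uniq.
  rewrite mxE; apply: le_trans (normc_sum _ _) _; apply: ler_sum => j _.
  by rewrite mxE normc_realM ler_wpM2r ?normc_ge0.
by rewrite -[leRHS]mule1 lee_wpmul2l.
Qed.

(** An entry is a coordinate of the image of a unit vector, whose norm is at
    most 1. *)
Lemma entry_le_ellp_opnorm m (M : 'M[R]_m.+1) (c : R) :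
  (ellp_opnorm p (map_mx (real_complex R) M) <= c%:E)%E ->
  forall i j, `|M i j| <= c.
Proof.
move=> Mc i j; rewrite -lee_fin; apply: le_trans Mc.
pose u : 'cV[R[i]]_m.+1 := \col_k unit_vector j k.
apply: (@le_trans _ _ (ellp_norm p (fun i => (map_mx (real_complex R) M *m u) i 0))).
  rewrite -[leLHS](_ : (Normc.normc ((map_mx (real_complex R) M *m u) i 0))%:E = _).
    exact: normc_le_ellp_norm.
  rewrite mxE (bigD1 j)//= !mxE /unit_vector eqxx mulr1 big1 ?addr0.
    by rewrite normc_real.
  by move=> k kj; rewrite !mxE /unit_vector (negbTE kj) mulr0.
apply: ereal_sup_ubound; exists u => //=.
rewrite (_ : (fun i => _) = unit_vector j); last by apply/funext => k; rewrite mxE.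
by apply: (ellp_norm_unit (@ord_int_inj m)).
Qed.

Section Sections.
Context {d : measure_display} {T : measurableType d} {N : nat -> nat}.
Context (w : forall n, 'I_(N n).+1 -> T) (A : (T -> R[i]) -> T -> R[i]).
Context (J : forall n, 'M[R]_((N n).+1)).
Context (sectionE : forall n, section_mx (@w n) A = map_mx (real_complex R) (J n)).

(** Necessity uses stability only through the boundedness of the entries of the
    inverses. *)
Lemma fsm_applicable_stable : fsm_applicable w p A ->
  exists c n0, forall n, (n0 <= n)%N ->
    J n \in unitmx /\ forall i j, `|invmx (J n) i j| <= c.
Proof.
move=> [_ [n0 [un]]]; set S := ereal_sup _ => Soo.
have S0 : (0 <= S)%E.
  apply: le_trans (ereal_sup_ubound _); last by exists n0; [exact: leqnn|reflexivity].
  apply: le_trans (ereal_sup_ubound _); last first.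
    exists 0 => //=; rewrite (_ : (fun i => _) = cst 0); last by apply/funext => i; rewrite mxE.
    rewrite /ellp_norm (_ : (fun _ => _) = cst 0%E).
      by rewrite Lnorm0 ?lee01// gt_eqF// (lt_le_trans _ p1).
    by apply/funext => i; rewrite /cst Normc.normc0.
  by rewrite /ellp_norm Lnorm_ge0.
exists (fine S), n0 => n n0n; split; first by have := un _ n0n; rewrite sectionE map_unitmx.
apply: entry_le_ellp_opnorm; rewrite fineK ?ge0_fin_numE//.
by apply: ereal_sup_ubound; exists n => //; rewrite sectionE map_invmx.
Qed.

Lemma stable_fsm_applicable (C r : R) n0 : invertible_operator p A ->
  0 < C -> 0 < r < 1 -> (forall n, (n0 <= n)%N -> J n \in unitmx /\
    forall i j, `|invmx (J n) i j| <= C * r ^+ `|i%:Z - j%:Z|%N) ->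
  fsm_applicable w p A.
Proof.
move=> iA C0 r01 H; split => //; exists n0; split => [n n0n|].
  by rewrite sectionE map_unitmx; case: (H _ n0n).
apply: (@le_lt_trans _ _ (C * (2 / (1 - r)))%:E); last by rewrite ltry.
apply: ge_ereal_sup => _ [n /= n0n <-]; rewrite sectionE -map_invmx.
by apply: ellp_opnorm_le => //; case: (H _ n0n).
Qed.
End Sections.
End Opnorm.

(** * Stability of the finite sections *)

Section Stability.
Context {R : realType} (v : int -> R) (K : nat) (K_gt0 : (0 < K)%N).
Context (mu : R) (up um : int -> R) (fp : floquet_pair v K mu up um).

Lemma geometric_small (M r e : R) : 0 < r < 1 -> 0 < e ->
  exists n0, forall n, (n0 <= n)%N -> M * r ^+ n < e.
Proof.
move=> /andP[r0 r1] e0.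
have /cvgr0_norm_lt/(_ _ e0)[n0 _ H] : geometric M r @ \oo --> 0.
  by apply: cvg_geometric; rewrite ger0_norm// ltW.
by exists n0 => n /H; exact: le_lt_trans (ler_norm _).
Qed.

Context (r A : R) (rates : decay_rates K mu up um r A).

Let r01 : 0 < r < 1. Proof. by case: rates. Qed.
Let A0 : 0 < A. Proof. by case: rates. Qed.

Definition green_const (b : R) : R :=
  2 * (A + A / b * A) ^+ 2 / `|wronskian um up 0|.

(** The constant depends on the section only through the lower bound b for the
    Floquet solutions at its two neighbours. The smallness condition keeps the
    Wronskian of the adapted solutions at least half that of um and up, in
    absolute value. *)
Lemma jacobi_uniform_bound (a : int) (N : nat) (b : R) : 0 < b ->
  b * r ^ (a - 1) <= `|up (a - 1)| ->
  b * r^-1 ^ (a + N%:Z + 1) <= `|um (a + N%:Z + 1)| ->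
  (A / b) ^+ 2 * r ^+ N <= 1 / 2 ->
  jacobi v a N \in unitmx /\ forall i j,
    `|invmx (jacobi v a N) i j| <= green_const b * r ^+ `|i%:Z - j%:Z|%N.
Proof.
move=> b0 bup bum small; have [r0 r1] := andP r01.
set c := a + N%:Z + 1 in bum *.
pose u := left_solution up um (a - 1); pose w := right_solution up um c.
have us : solution v u by apply: left_solution_sol fp _.
have ws : solution v w by apply: right_solution_sol fp _.
have ra : 0 < r ^ (a - 1) by rewrite exprz_gt0.
have ri0 : 0 < r^-1 by rewrite invr_gt0.
have rc : 0 < r^-1 ^ c by rewrite exprz_gt0.
have upa : up (a - 1) != 0.
  by rewrite -normr_gt0; apply: lt_le_trans bup; rewrite mulr_gt0.
have umc : um c != 0.
  by rewrite -normr_gt0; apply: lt_le_trans bum; rewrite mulr_gt0.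
set W0 := wronskian um up 0; have W0_neq0 : W0 != 0 := floquet_wronskian fp.
have WE := wronskian_left_right up um (a - 1) c.
set al := left_coef up um (a - 1) in WE; set ga := right_coef up um c in WE.
have alga : `|al * ga| <= 1 / 2.
  rewrite normrM; apply: le_trans small.
  have Hal := left_coef_bound rates b0 bup.
  have Hga := right_coef_bound rates b0 bum.
  apply: le_trans (ler_pM (normr_ge0 _) (normr_ge0 _) Hal Hga) _.
  rewrite mulrACA -expr2 -expfzDr ?gt_eqF// ler_wpM2l ?sqr_ge0//.
  by rewrite exprnP; apply: exprz_decr => //; rewrite /c; clear; lia.
have W_lower : `|W0| / 2 <= `|wronskian u w 0|.
  rewrite WE normrM ler_wpM2l//.
  have := lerB_dist 1 (al * ga); rewrite normr1; lra.
have nW0 : 0 < `|W0| by rewrite normr_gt0.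
have W_gt0 : 0 < `|wronskian u w 0| by apply: lt_le_trans W_lower; rewrite divr_gt0.
have W_neq0 : wronskian u w 0 != 0 by rewrite -normr_gt0.
have [Ju JE] := jacobi_green us ws W_neq0 (left_solution0 _ upa) (right_solution0 _ umc).
split => // i j; rewrite JE.
pose B := A + A / b * A.
have B0 : 0 < B by rewrite addr_gt0// mulr_gt0// divr_gt0.
have ij_le (k : int) : k = a + i%:Z \/ k = a + j%:Z -> a - 1 <= k /\ k <= c.
  have iN := ltn_ord i; have jN := ltn_ord j; rewrite /c.
  by clear - iN jN; lia.
have uB (k : int) : k = a + i%:Z \/ k = a + j%:Z -> `|u k| <= B * r^-1 ^ k.
  by move=> /ij_le[ak _]; exact: (left_solution_bound rates b0 bup ak).
have wB (k : int) : k = a + i%:Z \/ k = a + j%:Z -> `|w k| <= B * r ^ k.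
  by move=> /ij_le[_ kc]; exact: (right_solution_bound rates b0 bum kc).
have := green_bound W_neq0 r0 (ltW B0) (ltW B0) uB wB.
rewrite (_ : a + i%:Z - (a + j%:Z) = i%:Z - j%:Z); last by clear; lia.
move=> /le_trans; apply.
apply: ler_wpM2r; first by rewrite exprn_ge0// ltW.
rewrite /green_const -/B -/W0 -expr2 ler_pdivrMr// mulrAC ler_pdivlMr//.
rewrite [leRHS](_ : _ = B ^+ 2 * (2 * `|wronskian u w 0|)); last by ring.
rewrite ler_wpM2l ?sqr_ge0//.
by rewrite -ler_pdivrMl// mulrC.
Qed.

Lemma green_const_gt0 b : 0 < b -> 0 < green_const b.
Proof.
move=> b0; rewrite /green_const divr_gt0 ?normr_gt0 ?(floquet_wronskian fp)//.
by rewrite mulr_gt0// exprn_gt0// addr_gt0// mulr_gt0// divr_gt0.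
Qed.

Section Necessity.
Context (a : nat -> int) (N : nat -> nat).
Context (a_le0 : forall n, a n <= 0) (aN : forall n, a n + (N n)%:Z = n%:Z).
Context (c : R) (n0 : nat).
Context (stable : forall n, (n0 <= n)%N -> jacobi v (a n) (N n) \in unitmx /\
  forall i j, `|invmx (jacobi v (a n) (N n)) i j| <= c).

Let c0 : 0 <= c.
Proof. by have [_ /(_ ord0 ord0)] := stable (leqnn n0); exact: le_trans. Qed.

Let mu0 : 0 < `|mu|. Proof. by rewrite normr_gt0 (floquet_mu_neq0 fp). Qed.

(** Suppose um k = 0 and look at sections ending at k - 1 + m K, so that um vanishes
    at the right neighbour. The section maps um to a vector supported at the left
    end, where um is bounded, while at the right end um is of size |mu| ^ (- m).
    Bounded entries of the inverses exclude this for large m. The left end a n is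
    any nonpositive integer, which covers both the line and the half-line. *)
Lemma stable_um_neq0 k : um k != 0.
Proof.
have mu1 := floquet_mu_lt1 fp; have [_ _ _ _ umA] := rates.
apply/negP => /eqP umk.
have um1 : 0 < `|um (k - 1)|.
  by rewrite normr_gt0; apply: (floquet_um_next fp); rewrite subrK.
have [m0 Hm] := @geometric_small (c * A) `|mu| _ ltac:(by rewrite mu0) um1.
(* m >= |k| + 1 + n0 makes the right end k - 1 + m K at least n0, so that the
   section is a stable one. *)
pose m := (m0 + n0 + `|k|%N + 1)%N.
pose n := absz (k - 1 + (m * K)%N%:Z).
have mK : (m <= m * K)%N by rewrite leq_pmulr.
have nE : n%:Z = k - 1 + (m * K)%N%:Z by rewrite /n /m in mK *; clear - mK; lia.
have n0n : (n0 <= n)%N by move: nE mK; rewrite /m; clear; lia.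
have [Ju Jc] := stable n0n.
have shift j : um (j - (m * K)%N%:Z) = mu ^+ m * um j := floquet_perm_iter fp m j.
have umn1 : um (a n + (N n)%:Z + 1) = 0.
  apply/eqP; rewrite aN nE; have /eqP := shift (k + (m * K)%N%:Z).
  rewrite addrK umk eq_sym mulf_eq0 expf_eq0 (negbTE (floquet_mu_neq0 fp)) andbF /=.
  by rewrite (_ : k - 1 + (m * K)%N%:Z + 1 = k + (m * K)%N%:Z)//; clear; lia.
have := jacobi_unit_right Ju Jc (floquet_solm fp) umn1; rewrite aN nE => H.
have := Hm m ltac:(by rewrite /m; clear; lia); apply/negP; rewrite -leNgt.
have := shift (k - 1 + (m * K)%N%:Z); rewrite addrK => ->.
rewrite normrM normrX mulrC; apply: ler_wpM2r; first by rewrite exprn_ge0.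
apply: le_trans H _; apply: ler_wpM2l => //; apply: le_trans (umA _) _.
(* The left neighbour a n - 1 is negative, where um is bounded by A. *)
have [r0 r1] := andP r01.
rewrite -[leRHS]mulr1 ler_wpM2l ?(ltW A0)// exprz_inv -[leRHS](expr0z r).
by apply: exprz_decr => //; have := a_le0 n; clear; lia.
Qed.

(** The mirror image for up and the left ends - n of the sections of the line. *)
Lemma stable_up_neq0 k : (forall n, a n = - n%:Z) -> up k != 0.
Proof.
move=> aE; have mu1 := floquet_mu_lt1 fp; have [_ _ _ upA _] := rates.
apply/negP => /eqP upk.
have up1 : 0 < `|up (k + 1)| by rewrite normr_gt0; exact: (floquet_up_next fp).
have [m0 Hm] := @geometric_small (c * A) `|mu| _ ltac:(by rewrite mu0) up1.
(* The section starts at - n = k + 1 - m K, hence up vanishes at its left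
   neighbour k - m K. *)
pose m := (m0 + n0 + `|k|%N + 1)%N.
pose n := absz ((m * K)%N%:Z - (k + 1))%R.
have mK : (m <= m * K)%N by rewrite leq_pmulr.
have nE : n%:Z = (m * K)%N%:Z - (k + 1) by rewrite /n /m in mK *; clear - mK; lia.
have n0n : (n0 <= n)%N by move: nE mK; rewrite /m; clear; lia.
have [Ju Jc] := stable n0n.
have shift j : up (j + (m * K)%N%:Z) = mu ^+ m * up j := floquet_perp_iter fp m j.
have upn1 : up (a n - 1) = 0.
  apply/eqP; rewrite aE nE; have /eqP := shift (k - (m * K)%N%:Z).
  rewrite subrK upk eq_sym mulf_eq0 expf_eq0 (negbTE (floquet_mu_neq0 fp)) andbF /=.
  by rewrite (_ : - ((m * K)%N%:Z - (k + 1)) - 1 = k - (m * K)%N%:Z)//; clear; lia.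
have := jacobi_unit_left Ju Jc (floquet_solp fp) upn1.
rewrite aN (_ : a n = k + 1 - (m * K)%N%:Z); last by rewrite aE nE; clear; lia.
move=> H.
have := Hm m ltac:(by rewrite /m; clear; lia); apply/negP; rewrite -leNgt.
have := shift (k + 1 - (m * K)%N%:Z); rewrite subrK => ->.
rewrite normrM normrX mulrC; apply: ler_wpM2r; first by rewrite exprn_ge0.
apply: le_trans H _; apply: ler_wpM2l => //; apply: le_trans (upA _) _.
have [r0 r1] := andP r01.
rewrite -[leRHS]mulr1 ler_wpM2l ?(ltW A0)// -[leRHS](expr0z r).
by apply: exprz_decr => //; clear; lia.
Qed.
End Necessity.
End Stability.

(** * Applicability of the finite section method *)

Section Characterization.
Context {R : realType} (p : \bar R) (K : nat) (v : int -> R).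
Context (p1 : (1 <= p)%E) (K_gt0 : (0 < K)%N).
Context (v_per : forall k : int, v (k + K%:Z) = v k).

(** A damped solution is an approximate null vector when |tr M| <= 2. *)
Lemma invertible_trace : invertible_operator p (schroedinger v) ->
  2 < `|\tr (monodromy v K 0)|.
Proof.
move=> inv; rewrite ltNge; apply/negP => t2.
exact: (schroedinger_not_invertible K_gt0 v_per p1 t2).
Qed.

Lemma half_invertible_trace : invertible_operator p (schroedinger_half v) ->
  2 < `|\tr (monodromy v K 0)|.
Proof.
move=> inv; rewrite ltNge; apply/negP => t2.
exact: (schroedinger_half_not_invertible K_gt0 v_per p1 t2).
Qed.

Lemma fsm_applicable_Z : fsm_applicable windowZ p (schroedinger v) <->
  [/\ 2 < `|\tr (monodromy v K 0)|,
      forall j : 'I_K, passes_test (monodromy v K j%:Z)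
    & forall j : 'I_K, passes_test (monodromy_rev v K j%:Z)].
Proof.
have key : 2 < `|\tr (monodromy v K 0)| -> fsm_applicable windowZ p (schroedinger v) <->
    (forall j : 'I_K, passes_test (monodromy v K j%:Z)) /\
    (forall j : 'I_K, passes_test (monodromy_rev v K j%:Z)).
  move=> t2; have [mu [up [um fp]]] := exists_floquet_pair v_per t2.
  have [r [A rates]] := exists_decay_rates K_gt0 fp.
  have [r01 A0 muE _ _] := rates; have [r0 r1] := andP r01.
  split=> [fsm|[/(floquet_up_neq0P K_gt0 fp) up0 /(floquet_um_neq0P K_gt0 fp) um0]].
    have [c [n0 st]] := fsm_applicable_stable p1 (section_windowZ v) fsm.
    have aN n : - n%:Z + (n.*2)%:Z = n%:Z by clear; lia.
    have a0 n : - n%:Z <= 0 :> int by clear; lia.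
    split; [apply/(floquet_up_neq0P K_gt0 fp)|apply/(floquet_um_neq0P K_gt0 fp)] => k.
      by apply: (stable_up_neq0 K_gt0 fp rates aN st).
    by apply: (stable_um_neq0 K_gt0 fp rates a0 aN st).
  have [b b0 bup] := quasi_periodic_lower_bound K_gt0 r0 muE (floquet_perp fp) up0.
  have ri0 : 0 < r^-1 by rewrite invr_gt0.
  have muVE : `|mu^-1| = r^-1 ^+ K by rewrite normfV muE exprVn.
  have [b' b'0 bum] := quasi_periodic_lower_bound K_gt0 ri0 muVE (floquet_perm fp) um0.
  pose bb := Num.min b b'; have bb0 : 0 < bb by rewrite lt_min b0.
  have half0 : 0 < (1 / 2 : R) by rewrite divr_gt0.
  have [n0 small] := geometric_small ((A / bb) ^+ 2) r01 half0.
  have inv : invertible_operator p (schroedinger v).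
    by apply: (schroedinger_invertible K_gt0 v_per p1 fp).
  have G0 := green_const_gt0 fp rates bb0.
  apply: (stable_fsm_applicable p1 (section_windowZ v) inv G0 r01 (n0 := n0)).
  move=> n n0n; apply: (jacobi_uniform_bound fp rates bb0).
  - apply: le_trans (bup _); rewrite ler_wpM2r ?exprz_ge0 ?(ltW r0)//.
    by rewrite ge_min lexx.
  - apply: le_trans (bum _); rewrite ler_wpM2r ?exprz_ge0 ?invr_ge0 ?(ltW r0)//.
    by rewrite ge_min lexx orbT.
  - by apply/ltW/small; clear - n0n; lia.
split=> [fsm|[t2 H1 H2]]; last exact/key.
have t2 := invertible_trace fsm.1.
by have [H1 H2] := (key t2).1 fsm.
Qed.

Lemma fsm_applicable_N : fsm_applicable windowN p (schroedinger_half v) <->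
  [/\ 2 < `|\tr (monodromy v K 0)|,
      passes_test (monodromy v K 0)
    & forall j : 'I_K, passes_test (monodromy_rev v K j%:Z)].
Proof.
have key : 2 < `|\tr (monodromy v K 0)| -> fsm_applicable windowN p (schroedinger_half v) <->
    passes_test (monodromy v K 0) /\
    (forall j : 'I_K, passes_test (monodromy_rev v K j%:Z)).
  move=> t2; have [mu [up [um fp]]] := exists_floquet_pair v_per t2.
  have [r [A rates]] := exists_decay_rates K_gt0 fp.
  have [r01 A0 muE _ _] := rates; have [r0 r1] := andP r01.
  rewrite (passes_monodromy fp) sub0r.
  split=> [fsm|[up0 /(floquet_um_neq0P K_gt0 fp) um0]].
    have [c [n0 st]] := fsm_applicable_stable p1 (section_windowN v) fsm.
    have aN n : 0 + n%:Z = n%:Z by rewrite add0r.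
    split; first by case: fsm => [inv _]; exact: (schroedinger_half_invertible_up K_gt0 p1 fp inv).
    apply/(floquet_um_neq0P K_gt0 fp) => k.
    by apply: (stable_um_neq0 (a := fun=> 0) K_gt0 fp rates _ aN st).
  have ri0 : 0 < r^-1 by rewrite invr_gt0.
  have muVE : `|mu^-1| = r^-1 ^+ K by rewrite normfV muE exprVn.
  have [b' b'0 bum] := quasi_periodic_lower_bound K_gt0 ri0 muVE (floquet_perm fp) um0.
  pose b := `|up (-1)| / r ^ (-1).
  have rr : 0 < r ^ (-1) by rewrite exprz_gt0.
  have b0 : 0 < b by rewrite divr_gt0// normr_gt0.
  have bup : b * r ^ (-1) <= `|up (-1)| by rewrite divfK// gt_eqF.
  pose bb := Num.min b b'; have bb0 : 0 < bb by rewrite lt_min b0.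
  have half0 : 0 < (1 / 2 : R) by rewrite divr_gt0.
  have [n0 small] := geometric_small ((A / bb) ^+ 2) r01 half0.
  have inv : invertible_operator p (schroedinger_half v).
    by apply: (schroedinger_half_invertible K_gt0 v_per p1 fp up0).
  have G0 := green_const_gt0 fp rates bb0.
  apply: (stable_fsm_applicable p1 (section_windowN v) inv G0 r01 (n0 := n0)).
  move=> n n0n; apply: (jacobi_uniform_bound fp rates bb0).
  - rewrite sub0r; apply: le_trans bup; rewrite ler_wpM2r ?(ltW rr)//.
    by rewrite ge_min lexx.
  - apply: le_trans (bum _); rewrite ler_wpM2r ?exprz_ge0 ?invr_ge0 ?(ltW r0)//.
    by rewrite ge_min lexx orbT.
  - by apply/ltW/small.
split=> [fsm|[t2 H1 H2]]; last exact/key.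
have t2 := half_invertible_trace fsm.1.
by have [H1 H2] := (key t2).1 fsm.
Qed.
End Characterization.

Theorem theorem1p3 (R : realType) (p : \bar R) (K : nat) (v : int -> R)
    (p_ge1 : (1 <= p)%E) (K_gt0 : (0 < K)%N)
    (v_per : forall k : int, v (k + K%:Z) = v k) :
  [/\ fsm_applicable windowZ p (schroedinger v) <->
        [/\ 2 < `|\tr (monodromy v K 0)|,
            forall j : 'I_K, passes_test (monodromy v K j%:Z)
          & forall j : 'I_K, passes_test (monodromy_rev v K j%:Z)],
      fsm_applicable windowN p (schroedinger_half v) <->
        [/\ 2 < `|\tr (monodromy v K 0)|,
            passes_test (monodromy v K 0)
          & forall j : 'I_K, passes_test (monodromy_rev v K j%:Z)],
      fsm_applicable windowZ p (schroedinger v) ->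
        fsm_applicable windowN p (schroedinger_half v)
    & fsm_simple windowZ p (schroedinger v) ->
        fsm_simple windowN p (schroedinger_half v)].
Proof.
have Z := fsm_applicable_Z p_ge1 K_gt0 v_per.
have N := fsm_applicable_N p_ge1 K_gt0 v_per.
have ZN : fsm_applicable windowZ p (schroedinger v) ->
    fsm_applicable windowN p (schroedinger_half v).
  move=> /Z[t2 M1 M2]; apply/N; split => //.
  by have := M1 (Ordinal K_gt0).
split => // -[/ZN|ninv]; [by left|right => inv; apply: ninv].
have t2 := half_invertible_trace p_ge1 K_gt0 v_per inv.
have [mu [up [um fp]]] := exists_floquet_pair v_per t2.
exact: schroedinger_invertible fp.
Qed.
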